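(* It is provable in $RST_{HF}^m$ that every set $x$ with $x\subseteq\mathbb{R}$, $x\neq\emptyset$, and $x$ bounded above in $\mathbb{R}$ has a least upper bound in $\mathbb{R}$. Furthermore, the mapping assigning to each nonempty $\succ$-subset of $\mathbb{R}$ that is bounded above its least upper bound is a $\succ$-function, and its defining property is provable in $RST_{HF}^m$.
   Context: Formal setting: the language $\mathcal{L}_{RST}^{\{HF\}}$ is first-order with binary relations $\in,=$, a constant $HF$, connectives $\neg,\wedge,\vee$, $\exists$, and abstraction terms $\{x\mid\varphi\}$ allowed only when $\varphi\succ\{x\}$, where $\succ$ is the syntactic safety relation between formulas and finite sets of variables (atomic formulas are $\succ\emptyset$; for $x\notin Fv(t)$, $x\neq x$, $x\in t$, $x=t$, $t=x$ are $\succ\{x\}$; $\neg$ preserves $\succ\emptyset$; $\vee$ preserves $\succ\Theta$; $\varphi\succ\Theta,\psi\succ\Phi$ with $\Phi\cap Fv(\varphi)=\emptyset$ or $\Theta\cap Fv(\psi)=\emptyset$ give $\varphi\wedge\psi\succ\Theta\cup\Phi$; $\varphi\succ\Theta$, $y\in\Theta$ give $\exists y\varphi\succ\Theta\setminus\{y\}$). $RST_{HF}^m$ is the classical theory with Extensionality, Comprehension $\forall x(x\in\{x\mid\varphi\}\leftrightarrow\varphi)$ for legal terms, and the axioms $\emptyset\in HF$, $\forall x,y\in HF.\,x\cup\{y\}\in HF$, $\forall y(\emptyset\in y\wedge\forall v,w\in y.\,v\cup\{w\}\in y\to HF\subseteq y)$. Classes: for $\varphi\succ\emptyset$, $\{x\mid\varphi\}_c$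 is a class term (not a term); $t\in\{x\mid\varphi\}_c$ abbreviates $\varphi[t/x]$. $J_2$ is the second level of Jensen's hierarchy (smallest set containing the hereditarily finite sets $\mathcal{HF}$ as subset and element and closed under rudimentary functions), with $HF$ interpreted as $\mathcal{HF}$. A collection $X\subseteq J_2$ is a $\succ$-set if it is the value in $J_2$ of a closed term, and a $\succ$-class if it is $\{a\in J_2:\varphi(a)\text{ holds in }J_2\}$ for a closed class term $\{x\mid\varphi\}_c$. A $\succ$-function on a $\succ$-class $X$ is a $\succ$-class defined by $\{z\mid\exists x\exists y(z=\langle x,y\rangle\wedge x\in T\wedge y=t)\}_c$ for a closed class term $T$ defining $X$ and a term $t$ with $Fv(t)\subseteq\{x\}$. Reals: $\mathbb{Q}$ with its order is defined in the standard way as a $\succ$-set. $\mathbb{R}$ is the $\succ$-class of all $u\in J_2$ with $u\subseteq\mathbb{Q}$, $u\neq\emptyset$, $u\neq\mathbb{Q}$, $u$ downward closed in $\mathbb{Q}$ and with no greatest element (Dedekind cuts); the order on $\mathbb{R}$ is inclusion ($r<s$ iff $r\subsetneq s$, $r\le s$ iff $r\subseteq s$). $\mathbb{R}$ is a proper $\succ$-class, not a $\succ$-set. *)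

(* Defs.v *)
From mathcomp Require Import all_boot finmap.
From Stdlib Require List.

Set Implicit Arguments.
Unset Strict Implicit.
Unset Printing Implicit Defensive.

(** * Syntax of the language

    Binders ([Ex] and the abstraction [Abs phi], i.e. {x | phi}) use de Bruijn
    indices: the bound variable is index 0 of the body, and the variable n of
    the surrounding scope is index n.+1 there.  This is the raw syntax; the
    legality condition on abstraction terms is [wf_t] / [wf_f] below. *)

Inductive term : Type :=
| Var of nat
| HF
| Abs of form
with form : Type :=
| Mem of term & term
| Equ of term & term
| Neg of form
| And of form & form
| Or of form & form
| Ex of form.

Declare Scope rst_scope.
Delimit Scope rst_scope with rst.
Bind Scope rst_scope with term form.
Local Open Scope rst_scope.

Notation "# n" := (Var n) (at level 1, n at level 0, format "# n") : rst_scope.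
Notation "s ∈ t" := (Mem s t) (at level 70) : rst_scope.
Notation "s ≐ t" := (Equ s t) (at level 70) : rst_scope.
Notation "¬ f" := (Neg f) (at level 75, right associativity) : rst_scope.
Notation "f ∧ g" := (And f g) (at level 80, right associativity) : rst_scope.
Notation "f ∨ g" := (Or f g) (at level 85, right associativity) : rst_scope.
Notation "f ⇒ g" := (Or (Neg f) g) (at level 90, right associativity) : rst_scope.
Notation "f ⇔ g" := (And (Or (Neg f) g) (Or (Neg g) f))
  (at level 91, no associativity) : rst_scope.
Notation "'All' f" := (Neg (Ex (Neg f))) (at level 10, f at level 9) : rst_scope.

(** [fv_t n t], [fv_f n f]: the variable n occurs free. *)
Fixpoint fv_t (n : nat) (t : term) : bool :=
  match t with
  | Var m => m == n
  | HF => false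
  | Abs f => fv_f n.+1 f
  end
with fv_f (n : nat) (f : form) : bool :=
  match f with
  | Mem s t | Equ s t => fv_t n s || fv_t n t
  | Neg g => fv_f n g
  | And g h | Or g h => fv_f n g || fv_f n h
  | Ex g => fv_f n.+1 g
  end.

Definition scons (T : Type) (a : T) (e : nat -> T) (n : nat) : T :=
  if n is m.+1 then e m else a.
Notation "a .: e" := (scons a e) (at level 55, right associativity).

Definition up_ren (r : nat -> nat) : nat -> nat := 0 .: (fun n => (r n).+1).

Fixpoint ren_t (r : nat -> nat) (t : term) : term :=
  match t with
  | Var n => Var (r n)
  | HF => HF
  | Abs f => Abs (ren_f (up_ren r) f)
  end
with ren_f (r : nat -> nat) (f : form) : form :=
  match f with
  | Mem s t => Mem (ren_t r s) (ren_t r t)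
  | Equ s t => Equ (ren_t r s) (ren_t r t)
  | Neg g => Neg (ren_f r g)
  | And g h => And (ren_f r g) (ren_f r h)
  | Or g h => Or (ren_f r g) (ren_f r h)
  | Ex g => Ex (ren_f (up_ren r) g)
  end.

Notation "↑ t" := (ren_t succn t) (at level 9, t at level 8, format "↑ t") : rst_scope.

Definition up (s : nat -> term) : nat -> term := #0 .: (fun n => ↑(s n)).

Fixpoint subst_t (s : nat -> term) (t : term) : term :=
  match t with
  | Var n => s n
  | HF => HF
  | Abs f => Abs (subst_f (up s) f)
  end
with subst_f (s : nat -> term) (f : form) : form :=
  match f with
  | Mem t u => Mem (subst_t s t) (subst_t s u)
  | Equ t u => Equ (subst_t s t) (subst_t s u)
  | Neg g => Neg (subst_f s g)
  | And g h => And (subst_f s g) (subst_f s h)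
  | Or g h => Or (subst_f s g) (subst_f s h)
  | Ex g => Ex (subst_f (up s) g)
  end.

(** Replacing the outermost bound variable (index 0) by [u]. *)
Definition inst_t (t u : term) : term := subst_t (u .: Var) t.
Definition inst_f (f : form) (u : term) : form := subst_f (u .: Var) f.

(** * Safety relation and legal expressions *)

(** The variables of [X] other than 0, renumbered for the scope outside the
    binder: Theta \ {y} when y is the variable being bound. *)
Definition unbind (X : {fset nat}) : {fset nat} :=
  [fset n.-1 | n in (X `\ 0%N)%fset]%fset.

Definition fv_disj (X : {fset nat}) (f : form) : Prop :=
  forall n, n \in X -> ~~ fv_f n f.

Inductive wf_t : term -> Prop :=
| wf_Var n : wf_t #n
| wf_HF : wf_t HF
| wf_Abs f : safe f [fset 0%N]%fset -> wf_t (Abs f)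
with safe : form -> {fset nat} -> Prop :=
| safe_Mem s t : wf_t s -> wf_t t -> safe (s ∈ t) fset0
| safe_Equ s t : wf_t s -> wf_t t -> safe (s ≐ t) fset0
| safe_neq n : safe (¬ #n ≐ #n) [fset n]%fset
| safe_VarMem n t : wf_t t -> ~~ fv_t n t -> safe (#n ∈ t) [fset n]%fset
| safe_VarEqu n t : wf_t t -> ~~ fv_t n t -> safe (#n ≐ t) [fset n]%fset
| safe_EquVar n t : wf_t t -> ~~ fv_t n t -> safe (t ≐ #n) [fset n]%fset
| safe_Neg f : safe f fset0 -> safe (¬ f) fset0
| safe_Or f g X : safe f X -> safe g X -> safe (f ∨ g) X
| safe_And f g X Y : safe f X -> safe g Y ->
    fv_disj Y f \/ fv_disj X g -> safe (f ∧ g) (X `|` Y)%fset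
| safe_Ex f X : safe f X -> 0%N \in X -> safe (Ex f) (unbind X).

Fixpoint wf_f (f : form) : Prop :=
  match f with
  | Mem s t | Equ s t => wf_t s /\ wf_t t
  | Neg g | Ex g => wf_f g
  | And g h | Or g h => wf_f g /\ wf_f h
  end.

(** * Abbreviations

    Term and formula arguments live in the scope of the use site; only the body
    [f] of a bounded quantifier has one more variable (index 0). *)

Definition ExIn (t : term) (f : form) : form := Ex (#0 ∈ ↑t ∧ f).
Definition AllIn (t : term) (f : form) : form := ¬ Ex (#0 ∈ ↑t ∧ ¬ f).
Definition Subset (s t : term) : form := AllIn s (#0 ∈ ↑t).

Definition empty : term := Abs (¬ #0 ≐ #0).
Definition sg (t : term) : term := Abs (#0 ≐ ↑t).
Definition upair (s t : term) : term := Abs (#0 ≐ ↑s ∨ #0 ≐ ↑t).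
Definition cup (s t : term) : term := Abs (#0 ∈ ↑s ∨ #0 ∈ ↑t).
Definition opair (s t : term) : term := upair (sg s) (upair s t).

(** p = <x, y>.  The conjuncts with the bound u (witnessed by u = {x, y}) are
    redundant; they make the formula safe for {x, y} when x and y are distinct
    variables not free in p, as needed to bind x and y in a class term. *)
Definition is_opair (p x y : term) : form :=
  ExIn p (↑x ∈ #0 ∧ ↑y ∈ #0 ∧ ↑p ≐ opair ↑x ↑y).

Definition fst (p : term) : term :=
  Abs (Ex (Ex (is_opair ↑(↑(↑p)) #1 #0 ∧ #2 ∈ #1))).
Definition snd (p : term) : term :=
  Abs (Ex (Ex (is_opair ↑(↑(↑p)) #1 #0 ∧ #2 ∈ #0))).

Definition prod (s t : term) : term :=
  Abs (ExIn ↑s (ExIn ↑(↑t) (#2 ≐ opair #1 #0))).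

(** * The theory *)

Inductive axiom : form -> Prop :=
| ax_ext : axiom (All (All (All (#0 ∈ #2 ⇔ #0 ∈ #1) ⇒ #1 ≐ #0)))
| ax_compr f : safe f [fset 0%N]%fset -> axiom (All (#0 ∈ ↑(Abs f) ⇔ f))
| ax_HF_empty : axiom (empty ∈ HF)
| ax_HF_adj : axiom (AllIn HF (AllIn HF (cup #1 (sg #0) ∈ HF)))
| ax_HF_ind : axiom
    (All (empty ∈ #0 ∧ AllIn #0 (AllIn #1 (cup #1 (sg #0) ∈ #2)) ⇒ Subset HF #0)).

(** Classical natural deduction with equality over legal formulas, with [axiom]
    as non-logical axioms (open instances of [ax_compr] stand for their
    universal closures). *)
Inductive prv : seq form -> form -> Prop :=
| prv_ax G f : axiom f -> prv G f
| prv_hyp G f : wf_f f -> List.In f G -> prv G f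
| prv_NegI G f g : wf_f f -> prv (f :: G) g -> prv (f :: G) (¬ g) -> prv G (¬ f)
| prv_NegNegE G f : prv G (¬ ¬ f) -> prv G f
| prv_AndI G f g : prv G f -> prv G g -> prv G (f ∧ g)
| prv_AndE1 G f g : prv G (f ∧ g) -> prv G f
| prv_AndE2 G f g : prv G (f ∧ g) -> prv G g
| prv_OrI1 G f g : wf_f g -> prv G f -> prv G (f ∨ g)
| prv_OrI2 G f g : wf_f f -> prv G g -> prv G (f ∨ g)
| prv_OrE G f g h :
    prv G (f ∨ g) -> prv (f :: G) h -> prv (g :: G) h -> prv G h
| prv_ExI G f t : wf_f f -> wf_t t -> prv G (inst_f f t) -> prv G (Ex f)
| prv_ExE G f g :
    prv G (Ex f) -> prv (f :: map (ren_f succn) G) (ren_f succn g) -> prv G g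
| prv_EquI G t : wf_t t -> prv G (t ≐ t)
| prv_EquE G f s t :
    wf_f f -> prv G (s ≐ t) -> prv G (inst_f f s) -> prv G (inst_f f t).

Definition provable (f : form) : Prop := prv [::] f.

(** * Class terms

    The class term {x | f}_c is represented by [f] with x as index 0. *)

Definition closed_t (t : term) : Prop := forall n, ~~ fv_t n t.

Definition closed_class_term (C : form) : Prop :=
  safe C fset0 /\ forall n, fv_f n C -> n = 0%N.

(** Used for closed class terms only, which need no shifting under binders. *)
Definition inC (t : term) (C : form) : form := inst_f C t.

(** {z | exists x y, z = <x, y> /\ x in T /\ y = t(x)}_c *)
Definition fun_class (T : form) (t : term) : form :=
  Ex (Ex (is_opair #2 #1 #0 ∧ inC #1 T ∧ #0 ≐ inst_t t #1)).

(** * Rational numbers *)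

Definition trans (t : term) : form := AllIn t (Subset #0 ↑t).

(** Finite von Neumann ordinals: the transitive hereditarily finite sets all of
    whose elements are transitive. *)
Definition NN : term := Abs (#0 ∈ HF ∧ trans #0 ∧ AllIn #0 (trans #0)).
Definition one : term := sg empty.

(** Some hereditarily finite f restricts to a bijection from s to t. *)
Definition equinum (s t : term) : form :=
  ExIn HF
   (AllIn ↑s (ExIn ↑(↑t) (opair #1 #0 ∈ #2)) ∧
    AllIn ↑t (ExIn ↑(↑s) (opair #0 #1 ∈ #2)) ∧
    AllIn ↑s (AllIn ↑(↑s) (AllIn ↑(↑(↑t)) (AllIn ↑(↑(↑(↑t)))
      (opair #3 #1 ∈ #4 ∧ opair #2 #0 ∈ #4 ⇒ (#3 ≐ #2 ⇔ #1 ≐ #0)))))).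

(** The natural number equinumerous with s (if any, otherwise the empty set). *)
Definition card (s : term) : term :=
  Abs (ExIn NN (equinum #0 ↑(↑s) ∧ #1 ∈ #0)).

(** Arithmetic on natural numbers, as cardinal arithmetic. *)
Definition dsum (s t : term) : term := cup (prod s (sg empty)) (prod t (sg one)).
Definition add (s t : term) : term := card (dsum s t).
Definition mul (s t : term) : term := card (prod s t).
Definition divides (s t : term) : form := ExIn NN (mul ↑s #0 ≐ ↑t).
Definition coprimeT (s t : term) : form :=
  AllIn NN (divides #0 ↑s ∧ divides #0 ↑t ⇒ #0 ≐ one).

(** Integers: <n, 0> is n and <0, n> is -n. *)
Definition ZZ : term := cup (prod NN (sg empty)) (prod (sg empty) NN).
Definition absT (z : term) : term := cup (fst z) (snd z).

(** Rationals: pairs <z, d> with z an integer, d a positive natural number,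
    and z, d relatively prime. *)
Definition QQ : term :=
  Abs (ExIn ZZ (ExIn NN
    (¬ #0 ≐ empty ∧ coprimeT (absT #1) #0 ∧ #2 ≐ opair #1 #0))).

(** <<m,n>,d> < <<m',n'>,d'>  iff  (m - n) d' < (m' - n') d
                              iff  m d' + n' d < m' d + n d'. *)
Definition ltQ (p q : term) : form :=
  add (mul (fst (fst p)) (snd q)) (mul (snd (fst q)) (snd p)) ∈
  add (mul (fst (fst q)) (snd p)) (mul (snd (fst p)) (snd q)).

(** * Real numbers *)

(** Closed class term of the Dedekind cuts u (index 0).  [QQ] is closed, so it
    is not shifted under binders. *)
Definition RR : form :=
  Subset #0 QQ ∧ (¬ #0 ≐ empty) ∧ (¬ #0 ≐ QQ) ∧
  AllIn QQ (AllIn #1 (ltQ #1 #0 ⇒ #1 ∈ #2)) ∧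
  ¬ ExIn #0 (AllIn #1 (ltQ #0 #1 ∨ #0 ≐ #1)).

Definition upper_bound (x b : term) : form := AllIn x (Subset #0 ↑b).

(** x is a nonempty subset of R that is bounded above in R. *)
Definition bounded_subset (x : term) : form :=
  AllIn x (inC #0 RR) ∧ (¬ x ≐ empty) ∧ Ex (inC #0 RR ∧ upper_bound ↑x #0).

Definition is_lub (x s : term) : form :=
  inC s RR ∧ upper_bound x s ∧
  All (inC #0 RR ∧ upper_bound ↑x #0 ⇒ Subset ↑s #0).

Definition lub_exists : form := All (bounded_subset #0 ⇒ Ex (is_lub #1 #0)).

(** <x, y> is in the class F iff x is a nonempty bounded subset of R and y is
    its least upper bound. *)
Definition lub_property (F : form) : form :=
  All (All (inC (opair #1 #0) F ⇔ bounded_subset #1 ∧ is_lub #1 #0)).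

(** * The universe of sets and J_2 *)

(** Well-founded sets as trees, up to the extensional equality [eqV]. *)
Inductive V : Type := sup (A : Type) (x : A -> V).

Fixpoint eqV (x y : V) : Prop :=
  match x, y with
  | sup A f, sup B g =>
      (forall a, exists b, eqV (f a) (g b)) /\ (forall b, exists a, eqV (f a) (g b))
  end.

Definition idx (x : V) : Type := let: sup A _ := x in A.
Definition elt (x : V) : idx x -> V := let: sup _ f := x in f.

Definition memV (x y : V) : Prop := exists b : idx y, eqV x (elt b).
Definition subV (x y : V) : Prop := forall z, memV z x -> memV z y.

Definition emptyV : V := sup (fun a : Empty_set => match a with end).
Definition pairV (x y : V) : V := sup (fun b : bool => if b then x else y).
Definition diffV (x y : V) : V :=
  sup (fun a : {a : idx x | ~ memV (elt a) y} => elt (sval a)).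
Definition bigcupV (x : V) (g : V -> V) : V :=
  sup (fun a : {a : idx x & idx (g (elt a))} => elt (projT2 a)).
Definition adjV (x y : V) : V :=
  sup (fun a : option (idx x) => if a is Some b then elt b else y).
Definition opairV (x y : V) : V := pairV (pairV x x) (pairV x y).

(** The hereditarily finite sets: generated from the empty set by x, y |-> x U {y}. *)
Inductive hfcode : Set := hf0 | hfadj of hfcode & hfcode.

Fixpoint hfval (c : hfcode) : V :=
  match c with
  | hf0 => emptyV
  | hfadj a b => adjV (hfval a) (hfval b)
  end.

Definition HFV : V := sup hfval.

Definition consV n (z : V) (x : 'I_n -> V) (i : 'I_n.+1) : V :=
  if unlift ord0 i is Some j then x j else z.

Inductive rudimentary : forall n, (('I_n -> V) -> V) -> Prop :=
| rud_proj n (i : 'I_n) : rudimentary (fun x => x i)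
| rud_diff n (i j : 'I_n) : rudimentary (fun x => diffV (x i) (x j))
| rud_pair n (i j : 'I_n) : rudimentary (fun x => pairV (x i) (x j))
| rud_comp n k (g : ('I_k -> V) -> V) (h : 'I_k -> ('I_n -> V) -> V) :
    rudimentary g -> (forall i, rudimentary (h i)) ->
    rudimentary (fun x => g (fun i => h i x))
| rud_bigcup n (g : ('I_n.+1 -> V) -> V) :
    rudimentary g ->
    rudimentary (fun x : 'I_n.+1 -> V =>
      bigcupV (x ord0) (fun z => g (consV z (fun i => x (lift ord0 i))))).

Inductive J2 : V -> Prop :=
| J2_eq x y : eqV x y -> J2 x -> J2 y
| J2_HF_elt x : memV x HFV -> J2 x
| J2_HF : J2 HFV
| J2_rud n (f : ('I_n -> V) -> V) x :
    rudimentary f -> (forall i, J2 (x i)) -> J2 (f x).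

(** * Interpretation in J_2

    [value e t a]: the term t has value a in J_2 under the assignment e (whose
    values are in J_2).  Legal terms always have a value; [value] is a relation
    only so that the definition does not depend on that fact. *)

Fixpoint value (e : nat -> V) (t : term) (a : V) {struct t} : Prop :=
  match t with
  | Var n => eqV a (e n)
  | HF => eqV a HFV
  | Abs f => J2 a /\ forall b, J2 b -> (memV b a <-> sat (b .: e) f)
  end
with sat (e : nat -> V) (f : form) {struct f} : Prop :=
  match f with
  | Mem s t => exists a b, [/\ value e s a, value e t b & memV a b]
  | Equ s t => exists a b, [/\ value e s a, value e t b & eqV a b]
  | Neg g => ~ sat e g
  | And g h => sat e g /\ sat e h
  | Or g h => sat e g \/ sat e h
  | Ex g => exists a, J2 a /\ sat (a .: e) g
  end.

(** Closed expressions do not depend on the assignment. *)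
Definition env0 : nat -> V := fun _ => emptyV.

Definition is_succ_set (a : V) : Prop :=
  exists t, [/\ wf_t t, closed_t t & value env0 t a].

Definition class_ext (C : form) (a : V) : Prop := J2 a /\ sat (a .: env0) C.

(** The closed class term [C] defines the collection [X]. *)
Definition defines (C : form) (X : V -> Prop) : Prop :=
  closed_class_term C /\ forall a, X a <-> class_ext C a.

(** The collection of pairs [F] is the succ-function on [X] given by [T], [t]. *)
Definition is_succ_function (T : form) (t : term) (X F : V -> Prop) : Prop :=
  [/\ defines T X, wf_t t, (forall n, fv_t n t -> n = 0%N)
    & defines (fun_class T t) F].

Definition real : V -> Prop := class_ext RR.

Definition upper_boundV (a b : V) : Prop := forall r, memV r a -> subV r b.

Definition bounded_succ_subset (a : V) : Prop :=
  [/\ is_succ_set a, (forall r, memV r a -> real r), (exists r, memV r a)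
    & exists b, real b /\ upper_boundV a b].

Definition is_lubV (a s : V) : Prop :=
  [/\ real s, upper_boundV a s
    & forall b, real b -> upper_boundV a b -> subV s b].

(** The mapping from nonempty bounded succ-subsets of R to their least upper
    bounds, as a collection of ordered pairs. *)
Definition lub_map (z : V) : Prop :=
  exists a s, [/\ bounded_succ_subset a, is_lubV a s & eqV z (opairV a s)].

(* Main.v *)
From mathcomp Require Import all_boot finmap.
From Stdlib Require Import Classical ClassicalEpsilon FunctionalExtensionality.
Require Import Defs.

Set Implicit Arguments.
Unset Strict Implicit.
Unset Printing Implicit Defensive.
Local Open Scope rst_scope.

(** The union of a nonempty bounded set x of cuts is a cut, and it is the least
    upper bound of x; conversely x is bounded as soon as its union is a cut, so
    that boundedness has a safe definition although "some real bounds x" is not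
    safe.  Nothing about the rationals or their order is used.  This argument is
    carried out once, in every extensional structure with an empty set, pairs and
    unions.  A Henkin construction, whose models have the variables as elements,
    turns it into provability; applied to J_2 it gives the statements on
    succ-functions, once every element of J_2 is known to be the value of a
    closed term, by induction on rudimentary functions. *)

(* Existence of a bound in R is unsafe because [safe_Ex] wants the quantified variable in the safe
   set, while [RR] is a conjunction of negations and so safe only for the empty set;
   [inC (big_cup #0) RR] is a substitution instance of [RR] and stays safe. Of completeness, only
   the passage from validity to derivability occurs, and [structure] asks for less than a model of
   the theory: an abstraction term may lack a value in it. Equality is interpreted by a congruence,
   so that trees up to [eqV] and variables up to provable equality both serve without a quotient.
   Variables can act as Henkin constants because the construction starts from one formula and adds
   finitely many at each step, so a fresh variable always remains. *)
Scheme term_form_ind := Induction for term Sort Prop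
with form_term_ind := Induction for form Sort Prop.
Combined Scheme syntax_ind from term_form_ind, form_term_ind.

Scheme wf_safe_ind := Minimality for wf_t Sort Prop
with safe_wf_ind := Minimality for safe Sort Prop.
Combined Scheme wf_t_safe_ind from wf_safe_ind, safe_wf_ind.

(** * Renaming and substitution *)

Lemma up_ren_comp r s : up_ren r \o up_ren s = up_ren (r \o s).
Proof. by apply: functional_extensionality => -[]. Qed.

Lemma up_ren_id : up_ren id = id.
Proof. by apply: functional_extensionality => -[]. Qed.

Lemma up_ren_inj r : injective r -> injective (up_ren r).
Proof. by move=> rI [|m] [|n] //= [/rI ->]. Qed.

Lemma ren_comp :
  (forall t r s, ren_t r (ren_t s t) = ren_t (r \o s) t) /\
  (forall f r s, ren_f r (ren_f s f) = ren_f (r \o s) f).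
Proof.
by apply: syntax_ind => //= [f IH|s IHs t IHt|s IHs t IHt|g IH|g IHg h IHh
  |g IHg h IHh|g IH] r r'; rewrite ?IH ?IHs ?IHt ?IHg ?IHh ?up_ren_comp.
Qed.

Lemma ren_id : (forall t, ren_t id t = t) /\ (forall f, ren_f id f = f).
Proof.
by apply: syntax_ind => //= [f IH|s IHs t IHt|s IHs t IHt|g IH|g IHg h IHh
  |g IHg h IHh|g IH]; rewrite ?up_ren_id ?IH ?IHs ?IHt ?IHg ?IHh.
Qed.

Lemma ren_tC r t : ↑(ren_t r t) = ren_t (up_ren r) ↑t.
Proof. by rewrite !ren_comp.1. Qed.

Lemma ren_fC r f : ren_f succn (ren_f r f) = ren_f (up_ren r) (ren_f succn f).
Proof. by rewrite !ren_comp.2. Qed.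

Lemma ren_subst :
  (forall t r s, ren_t r (subst_t s t) = subst_t (ren_t r \o s) t) /\
  (forall f r s, ren_f r (subst_f s f) = subst_f (ren_t r \o s) f).
Proof.
have upE r s : ren_t (up_ren r) \o up s = up (ren_t r \o s).
  by apply: functional_extensionality => -[|n] //=; rewrite ren_tC.
by apply: syntax_ind => //= [f IH|s IHs t IHt|s IHs t IHt|g IH|g IHg h IHh
  |g IHg h IHh|g IH] r r'; rewrite ?IH ?IHs ?IHt ?IHg ?IHh ?upE.
Qed.

Lemma subst_ren :
  (forall t r s, subst_t s (ren_t r t) = subst_t (s \o r) t) /\
  (forall f r s, subst_f s (ren_f r f) = subst_f (s \o r) f).
Proof.
have upE r s : up s \o up_ren r = up (s \o r).
  by apply: functional_extensionality => -[].
by apply: syntax_ind => //= [f IH|s IHs t IHt|s IHs t IHt|g IH|g IHg h IHh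
  |g IHg h IHh|g IH] r r'; rewrite ?IH ?IHs ?IHt ?IHg ?IHh ?upE.
Qed.

Lemma ren_as_subst :
  (forall t r, ren_t r t = subst_t (Var \o r) t) /\
  (forall f r, ren_f r f = subst_f (Var \o r) f).
Proof.
have upE r : Var \o up_ren r = up (Var \o r).
  by apply: functional_extensionality => -[].
by apply: syntax_ind => //= [f IH|s IHs t IHt|s IHs t IHt|g IH|g IHg h IHh
  |g IHg h IHh|g IH] r; rewrite ?IH ?IHs ?IHt ?IHg ?IHh ?upE.
Qed.

Lemma ren_inst r f u :
  ren_f r (inst_f f u) = inst_f (ren_f (up_ren r) f) (ren_t r u).
Proof.
rewrite /inst_f ren_subst.2 subst_ren.2; congr subst_f.
by apply: functional_extensionality => -[].
Qed.

Lemma inst_var f k : inst_f f #k = ren_f (k .: id) f.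
Proof.
rewrite ren_as_subst.2; congr subst_f.
by apply: functional_extensionality => -[].
Qed.

Lemma inst_shift_t t u : inst_t ↑t u = t.
Proof. by rewrite /inst_t subst_ren.1 -[RHS]ren_id.1 ren_as_subst.1. Qed.

Lemma ren_scons_shift t (r : nat -> nat) k : ren_t (k .: r) ↑t = ren_t r t.
Proof. by rewrite ren_comp.1. Qed.

(** * Free variables *)

Lemma fv_ren :
  (forall t r k, fv_t k (ren_t r t) -> exists2 m, r m = k & fv_t m t) /\
  (forall f r k, fv_f k (ren_f r f) -> exists2 m, r m = k & fv_f m f).
Proof.
apply: syntax_ind => /= [n|//|f IH|s IHs t IHt|s IHs t IHt|g IH|g IHg h IHh
  |g IHg h IHh|g IH] r k; try by eauto.
- by move/eqP=> <-; exists n.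
- by move=> /IH [[|m] //= [<-] mf]; exists m.
- by case/orP=> [/IHs|/IHt] [m <- mf]; exists m; rewrite // mf ?orbT.
- by case/orP=> [/IHs|/IHt] [m <- mf]; exists m; rewrite // mf ?orbT.
- by case/orP=> [/IHg|/IHh] [m <- mf]; exists m; rewrite // mf ?orbT.
- by case/orP=> [/IHg|/IHh] [m <- mf]; exists m; rewrite // mf ?orbT.
- by move=> /IH [[|m] //= [<-] mf]; exists m.
Qed.

Lemma fv_shift k t : fv_t k.+1 ↑t -> fv_t k t.
Proof. by case/fv_ren.1 => m [->]. Qed.

Lemma fv_shift0 t : ~~ fv_t 0 ↑t.
Proof. by apply/negP => /fv_ren.1 []. Qed.

Lemma fv_subst :
  (forall t s k, fv_t k (subst_t s t) -> exists2 m, fv_t m t & fv_t k (s m)) /\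
  (forall f s k, fv_f k (subst_f s f) -> exists2 m, fv_f m f & fv_t k (s m)).
Proof.
apply: syntax_ind => /= [n|//|f IH|s IHs t IHt|s IHs t IHt|g IH|g IHg h IHh
  |g IHg h IHh|g IH] r k; try by eauto.
- by move=> /IH [[|m] //= mf /fv_shift]; exists m.
- by case/orP=> [/IHs|/IHt] [m mf mk]; exists m; rewrite // mf ?orbT.
- by case/orP=> [/IHs|/IHt] [m mf mk]; exists m; rewrite // mf ?orbT.
- by case/orP=> [/IHg|/IHh] [m mf mk]; exists m; rewrite // mf ?orbT.
- by case/orP=> [/IHg|/IHh] [m mf mk]; exists m; rewrite // mf ?orbT.
- by move=> /IH [[|m] //= mf /fv_shift]; exists m.
Qed.

(** * Legality is stable under substitution *)

Lemma in_unbind n (X : {fset nat}) : (n \in unbind X) = (n.+1 \in X).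
Proof.
apply/imfsetP/idP => /= [[[|m]]|nX]; first by rewrite !inE.
  by rewrite !inE /= => mX ->.
by exists n.+1; rewrite // !inE.
Qed.

Lemma safe_wf f X : safe f X -> wf_f f.
Proof. by elim=> //=; intros; split; auto; constructor. Qed.

(* The variables of [X] must stay variables and must not be captured by the
   terms substituted for the other ones.  The class [K] is used first for
   renamings and then, legality being stable under [↑], for all legal
   substitutions. *)
Lemma wf_safe_subst_class (K : (nat -> term) -> Prop) :
  (forall s, K s -> forall n, wf_t (s n)) -> (forall s, K s -> K (up s)) ->
  (forall t, wf_t t -> forall s, K s -> wf_t (subst_t s t)) /\
  (forall f X, safe f X -> forall s (r : nat -> nat), K s ->
    (forall n, n \in X -> s n = #(r n) /\ forall m, m != n -> ~~ fv_t (r n) (s m)) ->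
    safe (subst_f s f) (r @` X)%fset).
Proof.
move=> Kwf Kup.
have fresh t n (s : nat -> term) (r : nat -> nat) : ~~ fv_t n t ->
    (forall m, m != n -> ~~ fv_t (r n) (s m)) -> ~~ fv_t (r n) (subst_t s t).
  move=> /negP nt rn; apply/negP => /fv_subst.1 [m mt mr].
  by case: (eqVneq m n) mt => [-> //|/rn]; rewrite mr.
have disj f (X : {fset nat}) (s : nat -> term) (r : nat -> nat) : fv_disj X f ->
    (forall n, n \in X -> s n = #(r n) /\ forall m, m != n -> ~~ fv_t (r n) (s m)) ->
    fv_disj (r @` X)%fset (subst_f s f).
  move=> Xf sX _ /imfsetP [n /= nX ->]; apply/negP => /fv_subst.2 [m mf mr].
  by case: (eqVneq m n) mf => [->|/(sX n nX).2]; [apply/negP/Xf | rewrite mr].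
have sing n (r : nat -> nat) : (r @` [fset n])%fset = [fset r n]%fset.
  by rewrite imfset_fset1.
have img0 (r : nat -> nat) : (r @` fset0)%fset = fset0 by rewrite imfset0.
apply: wf_t_safe_ind => /=.
- by move=> n s /Kwf.
- by move=> *; constructor.
- move=> f _ IH s sK; constructor.
  rewrite -(sing 0 id); apply: IH (Kup _ sK) _ => n; rewrite inE => /eqP -> /=.
  by split=> // -[//|m] _ /=; apply: fv_shift0.
- by move=> s t _ IHs _ IHt r r' rK _; rewrite img0; constructor; auto.
- by move=> s t _ IHs _ IHt r r' rK _; rewrite img0; constructor; auto.
- move=> n s r sK /(_ n); rewrite inE eqxx => /(_ isT) [-> _].
  by rewrite sing; constructor.
- move=> n t _ IH nt s r sK /(_ n); rewrite inE eqxx => /(_ isT) [-> rn].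
  by rewrite sing; constructor; [apply: IH | apply: fresh].
- move=> n t _ IH nt s r sK /(_ n); rewrite inE eqxx => /(_ isT) [-> rn].
  by rewrite sing; constructor; [apply: IH | apply: fresh].
- move=> n t _ IH nt s r sK /(_ n); rewrite inE eqxx => /(_ isT) [-> rn].
  by rewrite sing; constructor; [apply: IH | apply: fresh].
- move=> f _ IH s r sK _; rewrite img0; constructor; rewrite -(img0 r).
  by apply: IH => // n; rewrite inE.
- by move=> f g X _ IHf _ IHg s r sK rX; constructor; auto.
- move=> f g X Y _ IHf _ IHg XY s r sK rXY.
  have rX n : n \in X -> s n = #(r n) /\ forall m, m != n -> ~~ fv_t (r n) (s m).
    by move=> nX; apply: rXY; rewrite inE nX.
  have rY n : n \in Y -> s n = #(r n) /\ forall m, m != n -> ~~ fv_t (r n) (s m).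
    by move=> nY; apply: rXY; rewrite inE nY orbT.
  rewrite imfsetU; constructor; [exact: IHf | exact: IHg|].
  by case: XY => [Yf|Xg]; [left|right]; apply: disj.
- move=> f X _ IH X0 s r sK rX.
  (* Renaming commutes with leaving a binder: [up_ren r] fixes 0 and acts as [r] one level up, so 0
     may be discarded before or after. *)
  have -> : (r @` unbind X)%fset = unbind (up_ren r @` X)%fset.
    apply/fsetP => k; rewrite in_unbind; apply/imfsetP/imfsetP => /= [[n nX ->]|].
      by exists n.+1; rewrite // -in_unbind.
    by case=> -[//|n] nX [->]; exists n; rewrite // in_unbind.
  constructor; last by apply/imfsetP; exists 0.
  apply: IH (Kup _ sK) _ => -[|n] nX.
    by split=> // -[//|m] _; apply: fv_shift0.
  rewrite -in_unbind in nX; have [sn rn] := rX _ nX.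
  split=> /= [|[|m] //= mn]; first by rewrite sn.
  by apply/negP => /fv_shift; apply/negP/rn.
Qed.

(** For a renaming, the non-capture condition is injectivity: [r n] occurs in [#(r m)] only if
    [m = n]. *)
Lemma wf_safe_ren :
  (forall t, wf_t t -> forall r, injective r -> wf_t (ren_t r t)) /\
  (forall f X, safe f X -> forall r, injective r -> safe (ren_f r f) (r @` X)%fset).
Proof.
have [|s [r [-> rI]]|wr sr] :=
  @wf_safe_subst_class (fun s => exists r, s = Var \o r /\ injective r).
- by move=> s [r [-> _]] n; constructor.
- exists (up_ren r); split; last exact: up_ren_inj.
  by apply: functional_extensionality => -[].
split=> [t /wr tw r rI|f X /sr fs r rI].
  by rewrite ren_as_subst.1; apply: tw; exists r.
rewrite ren_as_subst.2; apply: fs; first by exists r.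
by move=> n _; split=> //= m; apply: contra => /eqP /rI ->.
Qed.

Lemma wf_shift t : wf_t t -> wf_t ↑t.
Proof. by move=> tw; apply: wf_safe_ren.1 => // ? ? []. Qed.

Lemma wf_safe_subst :
  (forall t, wf_t t -> forall s, (forall n, wf_t (s n)) -> wf_t (subst_t s t)) /\
  (forall f X, safe f X -> forall s (r : nat -> nat), (forall n, wf_t (s n)) ->
    (forall n, n \in X -> s n = #(r n) /\ forall m, m != n -> ~~ fv_t (r n) (s m)) ->
    safe (subst_f s f) (r @` X)%fset).
Proof.
apply: wf_safe_subst_class => // s sw [|n] /=; first by constructor.
exact: wf_shift.
Qed.

Lemma wf_f_subst f s : wf_f f -> (forall n, wf_t (s n)) -> wf_f (subst_f s f).
Proof.
have wf_up r : (forall n, wf_t (r n)) -> forall n, wf_t (up r n).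
  by move=> rw [|n] /=; [constructor | apply: wf_shift].
elim: f s => /= [t u|t u|g IH|g IHg h IHh|g IHg h IHh|g IH] s fw sw; auto;
  by case: fw; split; auto; apply: wf_safe_subst.1.
Qed.

(** Stated for arbitrary renamings because an assignment into a Henkin model maps variables to
    variables and may identify some of them. *)
Lemma wf_f_ren f r : wf_f f -> wf_f (ren_f r f).
Proof.
by move=> fw; rewrite ren_as_subst.2; apply: wf_f_subst => // n; constructor.
Qed.

Lemma wf_t_ren t r : wf_t t -> wf_t (ren_t r t).
Proof.
by move=> tw; rewrite ren_as_subst.1; apply: wf_safe_subst.1 => // n; constructor.
Qed.

Lemma wf_inst f u : wf_f f -> wf_t u -> wf_f (inst_f f u).
Proof. by move=> fw uw; apply: wf_f_subst => // -[|n] //=; constructor. Qed.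

(** A lifted renaming fixes 0 and sends every other index to a successor, so no variable is
    identified with the abstracted one, even without injectivity. Hence instances of comprehension
    are closed under all renamings. *)
Lemma safe_up_ren f r :
  safe f [fset 0%N]%fset -> safe (ren_f (up_ren r) f) [fset 0%N]%fset.
Proof.
move=> /wf_safe_subst.2 fs; rewrite ren_as_subst.2.
have -> : [fset 0%N]%fset = (id @` [fset 0%N])%fset :> {fset nat}.
  by rewrite imfset_fset1.
apply: fs => [n|n]; first by constructor.
by rewrite inE => /eqP ->; split=> // -[].
Qed.

Lemma safe_inst f u : safe f fset0 -> wf_t u -> safe (inst_f f u) fset0.
Proof.
move=> /wf_safe_subst.2 fs uw.
have -> : fset0 = (id @` fset0)%fset :> {fset nat} by rewrite imfset0.
by apply: fs => [[|n] //=|n]; [constructor | rewrite inE].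
Qed.

(** * Legality of the defined notions *)

Lemma fv_disj0 f : fv_disj fset0 f.
Proof. by move=> n; rewrite inE. Qed.

Lemma fv_disj1 n f : ~~ fv_f n f -> fv_disj [fset n]%fset f.
Proof. by move=> nf m; rewrite inE => /eqP ->. Qed.

Lemma safe_And0 f g : safe f fset0 -> safe g fset0 -> safe (f ∧ g) fset0.
Proof.
by move=> fs gs; rewrite -(fsetU0 fset0); constructor=> //; left; apply: fv_disj0.
Qed.

Lemma safe_And0r f g X : safe f X -> safe g fset0 -> safe (f ∧ g) X.
Proof.
by move=> fs gs; rewrite -(fsetU0 X); constructor=> //; left; apply: fv_disj0.
Qed.

Lemma safe_And0l f g X : safe f fset0 -> safe g X -> safe (f ∧ g) X.
Proof.
by move=> fs gs; rewrite -(fset0U X); constructor=> //; right; apply: fv_disj0.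
Qed.

Lemma unbind1 n : unbind ([fset 0] `|` [fset n.+1])%fset = [fset n]%fset.
Proof. by apply/fsetP => k; rewrite in_unbind !inE /= eqSS. Qed.

Lemma safe_ExIn t f : wf_t t -> safe f fset0 -> safe (ExIn t f) fset0.
Proof.
move=> tw fs; have -> : fset0 = unbind [fset 0%N]%fset.
  by apply/fsetP => k; rewrite in_unbind !inE.
constructor; last by rewrite inE.
apply: safe_And0r fs; constructor; [exact: wf_shift | exact: fv_shift0].
Qed.

(** The quantified variable is generated by [#0 ∈ ↑t] and the outer one by [f]; the conjunction rule
    applies because the outer one does not occur in [t]. Unbinding then turns [n.+1] back into
    [n]. *)
Lemma safe_ExIn1 n t f : wf_t t -> ~~ fv_t n t -> safe f [fset n.+1]%fset ->
  safe (ExIn t f) [fset n]%fset.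
Proof.
move=> tw nt fs; rewrite -unbind1; constructor; last by rewrite !inE.
constructor=> //; first by constructor; [exact: wf_shift | exact: fv_shift0].
left; apply: fv_disj1 => /=; apply/negP => /fv_shift.
by rewrite (negPf nt).
Qed.

Lemma safe_AllIn t f : wf_t t -> safe f fset0 -> safe (AllIn t f) fset0.
Proof.
move=> tw fs; constructor; apply: (@safe_ExIn t (¬ f)) => //.
by constructor.
Qed.

Lemma safe_Subset s t : wf_t s -> wf_t t -> safe (Subset s t) fset0.
Proof.
move=> sw tw; apply: safe_AllIn => //; constructor; last exact: wf_shift.
by constructor.
Qed.

Lemma wf_empty : wf_t empty.
Proof. by constructor; constructor. Qed.

Lemma wf_sg t : wf_t t -> wf_t (sg t).
Proof.
by move=> tw; constructor; constructor; [exact: wf_shift | exact: fv_shift0].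
Qed.

Lemma wf_upair s t : wf_t s -> wf_t t -> wf_t (upair s t).
Proof.
move=> sw tw; constructor; constructor; constructor;
  by [exact: wf_shift | exact: fv_shift0].
Qed.

Lemma wf_cup s t : wf_t s -> wf_t t -> wf_t (cup s t).
Proof.
move=> sw tw; constructor; constructor; constructor;
  by [exact: wf_shift | exact: fv_shift0].
Qed.

Lemma wf_opair s t : wf_t s -> wf_t t -> wf_t (opair s t).
Proof. by move=> sw tw; apply: wf_upair; [apply: wf_sg | apply: wf_upair]. Qed.

Lemma wf_one : wf_t one.
Proof. exact/wf_sg/wf_empty. Qed.

Create HintDb legal.
Hint Resolve wf_Var wf_HF wf_shift wf_empty wf_sg wf_upair wf_cup wf_opair wf_one
  safe_Mem safe_Equ safe_Neg safe_Or safe_And0 safe_ExIn safe_AllIn safe_Subset : legal.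

Definition big_cup (t : term) : term := Abs (ExIn ↑t (#1 ∈ #0)).

Lemma wf_big_cup t : wf_t t -> wf_t (big_cup t).
Proof.
move=> tw; constructor; apply: safe_ExIn1; first exact: wf_shift.
  exact: fv_shift0.
by constructor; auto with legal.
Qed.

Lemma fv_sg k t : fv_t k (sg t) -> fv_t k t.
Proof. exact: fv_shift. Qed.

Lemma fv_upair k s t : fv_t k (upair s t) -> fv_t k s || fv_t k t.
Proof. by case/orP => /fv_shift ->; rewrite ?orbT. Qed.

Lemma fv_cup k s t : fv_t k (cup s t) -> fv_t k s || fv_t k t.
Proof. by case/orP => /fv_shift ->; rewrite ?orbT. Qed.

Lemma fv_opair k s t : fv_t k (opair s t) -> fv_t k s || fv_t k t.
Proof. by case/fv_upair/orP => [/fv_sg ->|/fv_upair]. Qed.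

Lemma fv_is_opair k p x y :
  fv_f k (is_opair p x y) -> [|| fv_t k p, fv_t k x | fv_t k y].
Proof.
rewrite /is_opair /ExIn.
move=> /orP [|/orP [|/orP [|]]] /orP [] //; do ?[by move=> /fv_shift ->; rewrite ?orbT].
by move=> /fv_opair /orP [] /fv_shift ->; rewrite ?orbT.
Qed.

(** Safety spreads along membership: [p] generates the bound u, then u generates [m] and [n]. At
    each conjunction the variables generated on the right are absent from the left conjunct, since
    [m] and [n] differ and are not free in [p]. *)
Lemma safe_is_opair m n p : m != n -> ~~ fv_t m p -> ~~ fv_t n p -> wf_t p ->
  safe (is_opair p #m #n) ([fset m] `|` [fset n])%fset.
Proof.
move=> mn mp np pw.
have -> : ([fset m] `|` [fset n])%fset =
    unbind ([fset 0] `|` ([fset m.+1] `|` [fset n.+1]))%fset.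
  by apply/fsetP => k; rewrite in_unbind !inE /= !eqSS.
constructor; last by rewrite !inE.
constructor; first by constructor; [exact: wf_shift | exact: fv_shift0].
  constructor; first by constructor; auto with legal.
    apply: safe_And0r; first by constructor; auto with legal.
    by auto 10 with legal.
  by left; apply: fv_disj1; rewrite /= eqSS orbF.
left=> k; rewrite !inE => /orP [] /eqP -> /=; apply/negP => /fv_shift.
  by rewrite (negPf mp).
by rewrite (negPf np).
Qed.

(** Shared by both projections: [is_opair] generates the two components, and [f] generates the
    abstracted variable, which has index 2 beneath the two quantifiers and does not occur in the
    shifted [p]. *)
Lemma wf_pair_abs f p : wf_t p -> safe f [fset 2]%fset ->
  wf_t (Abs (Ex (Ex (is_opair ↑(↑(↑p)) #1 #0 ∧ f)))).
Proof.
move=> pw fs; constructor.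
have -> : [fset 0]%fset =
    unbind (unbind (([fset 1] `|` [fset 0]) `|` [fset 2]))%fset.
  by apply/fsetP => k; rewrite !in_unbind !inE /= !eqSS.
constructor; last by rewrite in_unbind !inE.
constructor; last by rewrite !inE.
constructor=> //.
  apply: safe_is_opair => //; last by auto with legal.
    by apply/negP => /fv_shift; apply/negP/fv_shift0.
  exact: fv_shift0.
left; apply: fv_disj1; apply/negP => /fv_is_opair /orP [] //.
by do 2 move=> /fv_shift; apply/negP/fv_shift0.
Qed.

Lemma wf_fst p : wf_t p -> wf_t (fst p).
Proof. by move=> pw; apply: wf_pair_abs => //; constructor; auto with legal. Qed.

Lemma wf_snd p : wf_t p -> wf_t (snd p).
Proof. by move=> pw; apply: wf_pair_abs => //; constructor; auto with legal. Qed.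

Lemma wf_prod s t : wf_t s -> wf_t t -> wf_t (prod s t).
Proof.
move=> sw tw; constructor; apply: safe_ExIn1; [by auto with legal | exact: fv_shift0|].
apply: safe_ExIn1; [by auto with legal | | by constructor; auto with legal].
by apply/negP => /fv_shift; apply/negP/fv_shift0.
Qed.

Lemma safe_trans t : wf_t t -> safe (trans t) fset0.
Proof. by move=> tw; rewrite /trans; auto with legal. Qed.

Hint Resolve wf_big_cup wf_fst wf_snd wf_prod safe_trans : legal.

Lemma wf_NN : wf_t NN.
Proof.
constructor; apply: safe_And0r; first by constructor; auto with legal.
by auto with legal.
Qed.

Hint Resolve wf_NN : legal.

Lemma safe_equinum s t : wf_t s -> wf_t t -> safe (equinum s t) fset0.
Proof. by move=> sw tw; rewrite /equinum; auto 30 with legal. Qed.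

Lemma wf_card s : wf_t s -> wf_t (card s).
Proof.
move=> sw; constructor; apply: safe_ExIn1; [exact: wf_NN | by []|].
apply: safe_And0l; first by apply: safe_equinum; auto with legal.
by constructor; auto with legal.
Qed.

Lemma wf_add s t : wf_t s -> wf_t t -> wf_t (add s t).
Proof. by move=> sw tw; apply: wf_card; rewrite /dsum; auto with legal. Qed.

Lemma wf_mul s t : wf_t s -> wf_t t -> wf_t (mul s t).
Proof. by move=> sw tw; apply: wf_card; auto with legal. Qed.

Hint Resolve wf_add wf_mul : legal.

Lemma safe_divides s t : wf_t s -> wf_t t -> safe (divides s t) fset0.
Proof. by move=> sw tw; rewrite /divides; auto with legal. Qed.

Hint Resolve safe_divides : legal.

Lemma safe_coprimeT s t : wf_t s -> wf_t t -> safe (coprimeT s t) fset0.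
Proof. by move=> sw tw; rewrite /coprimeT; auto 10 with legal. Qed.

Lemma wf_ZZ : wf_t ZZ.
Proof. by rewrite /ZZ; auto with legal. Qed.

Lemma wf_absT z : wf_t z -> wf_t (absT z).
Proof. by rewrite /absT; auto with legal. Qed.

Hint Resolve safe_coprimeT wf_ZZ wf_absT : legal.

Lemma wf_QQ : wf_t QQ.
Proof.
constructor; apply: safe_ExIn1; [by auto with legal | by []|].
apply: safe_ExIn1; [by auto with legal | by []|].
do 2![apply: safe_And0l; first by auto 10 with legal].
by constructor; auto with legal.
Qed.

Lemma safe_ltQ p q : wf_t p -> wf_t q -> safe (ltQ p q) fset0.
Proof. by move=> pw qw; rewrite /ltQ; auto 10 with legal. Qed.

Hint Resolve wf_QQ safe_ltQ : legal.

Lemma safe_RR : safe RR fset0.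
Proof. by rewrite /RR; auto 20 with legal. Qed.

Hint Resolve safe_RR : legal.

Lemma safe_inC t C : safe C fset0 -> wf_t t -> safe (inC t C) fset0.
Proof. exact: safe_inst. Qed.

Hint Resolve safe_inC : legal.

(* A nonempty set of cuts is bounded above in R iff its union is a cut, and
   unlike [bounded_subset] the latter condition is safe. *)
Definition bounded_class : form :=
  AllIn #0 (inC #0 RR) ∧ (¬ #0 ≐ empty) ∧ inC (big_cup #0) RR.

Lemma closed_bounded_class : closed_class_term bounded_class.
Proof.
split; first by rewrite /bounded_class; auto 20 with legal.
(* On this concrete formula, freeness of a successor index computes to false. *)
by case.
Qed.

(** Both quantified variables are generated by the pair itself, so [T] may well be a proper
    class. *)
Lemma safe_fun_class T t : safe T fset0 -> wf_t t -> safe (fun_class T t) fset0.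
Proof.
move=> Ts tw.
have -> : fset0 = unbind (unbind ([fset 1] `|` [fset 0]))%fset.
  by apply/fsetP => k; rewrite !in_unbind !inE.
constructor; last by rewrite in_unbind !inE.
constructor; last by rewrite !inE.
apply: safe_And0r; first by apply: safe_is_opair => //; constructor.
apply: safe_And0; first by auto with legal.
constructor; first by constructor.
by apply: wf_safe_subst.1 => // -[|n]; constructor.
Qed.

Lemma closed_lub_class : closed_class_term (fun_class bounded_class (big_cup #0)).
Proof.
split; last by case.
by apply: safe_fun_class; [apply: closed_bounded_class.1 | auto with legal].
Qed.

Lemma wf_inC t C : safe C fset0 -> wf_t t -> wf_f (inC t C).
Proof. by move=> Cs tw; apply/safe_wf/safe_inst. Qed.

Lemma safe_upper_bound x b : wf_t x -> wf_t b -> safe (upper_bound x b) fset0.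
Proof. by rewrite /upper_bound; auto with legal. Qed.

Lemma wf_bounded_subset x : wf_t x -> wf_f (bounded_subset x).
Proof.
move=> xw; split; first by apply: (@safe_wf _ fset0); auto with legal.
split; first by split=> //; apply: wf_empty.
split; first by apply: wf_inC; auto with legal.
by apply: safe_wf; apply: safe_upper_bound; auto with legal.
Qed.

Lemma wf_is_lub x s : wf_t x -> wf_t s -> wf_f (is_lub x s).
Proof.
move=> xw sw; split; first by apply: wf_inC; auto with legal.
split; first exact: safe_wf (safe_upper_bound xw sw).
split; last by apply: (@safe_wf _ fset0); auto with legal.
split; first by apply: wf_inC; auto with legal.
by apply: safe_wf; apply: safe_upper_bound; auto with legal.
Qed.

Lemma wf_lub_exists : wf_f lub_exists.
Proof.
by split; [apply: wf_bounded_subset | apply: wf_is_lub]; auto with legal.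
Qed.

Lemma wf_lub_property F : safe F fset0 -> wf_f (lub_property F).
Proof.
move=> Fs; have Pw : wf_f (inC (opair #1 #0) F) by apply: wf_inC; auto with legal.
have Lw : wf_f (bounded_subset #1 ∧ is_lub #1 #0).
  by split; [apply: wf_bounded_subset | apply: wf_is_lub]; auto with legal.
by split; split.
Qed.

(** * Structures for the language *)

Section Semantics.
Variables (M : Type) (D : M -> Prop) (E I : M -> M -> Prop) (h : M).

(* Convertible to [value] and [sat] for [V], [J2], [eqV], [memV], [HFV]. *)
Fixpoint val (e : nat -> M) (t : term) (a : M) {struct t} : Prop :=
  match t with
  | Var n => E a (e n)
  | HF => E a h
  | Abs f => D a /\ forall b, D b -> (I b a <-> holds (b .: e) f)
  end
with holds (e : nat -> M) (f : form) {struct f} : Prop :=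
  match f with
  | Mem s t => exists a b, [/\ val e s a, val e t b & I a b]
  | Equ s t => exists a b, [/\ val e s a, val e t b & E a b]
  | Neg g => ~ holds e g
  | And g h => holds e g /\ holds e h
  | Or g h => holds e g \/ holds e h
  | Ex g => exists a, D a /\ holds (a .: e) g
  end.

(** What the supremum argument consumes of a model. [D] carves the domain out of [M] as [J2] is
    carved out of [V]; the three existence fields provide values for [empty], for pairs and for
    [big_cup]. *)
Record structure : Prop := Structure {
  E_refl : forall a, E a a;
  E_sym : forall a b, E a b -> E b a;
  E_trans : forall a b c, E a b -> E b c -> E a c;
  I_congr : forall a b c d, E a b -> E c d -> I a c -> I b d;
  D_congr : forall a b, E a b -> D a -> D b;
  D_h : D h;
  I_ext : forall a b, D a -> D b -> (forall c, D c -> (I c a <-> I c b)) -> E a b;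
  has_empty : exists a, D a /\ forall b, D b -> ~ I b a;
  has_pair : forall a b, D a -> D b ->
    exists c, D c /\ forall d, D d -> (I d c <-> E d a \/ E d b);
  has_union : forall a, D a ->
    exists c, D c /\ forall d, D d -> (I d c <-> exists b, [/\ D b, I b a & I d b])
}.

Lemma scons_ren (a : M) e r : (a .: e) \o up_ren r = a .: (e \o r).
Proof. by apply: functional_extensionality => -[]. Qed.

Lemma val_holds_ren :
  (forall t e r a, val e (ren_t r t) a <-> val (e \o r) t a) /\
  (forall f e r, holds e (ren_f r f) <-> holds (e \o r) f).
Proof.
apply: syntax_ind => //= [f IH|s IHs t IHt|s IHs t IHt|g IH|g IHg h' IHh
  |g IHg h' IHh|g IH] e r.
- by move=> a; split=> -[aD aP]; split=> // b bD; rewrite aP // IH scons_ren.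
- by split=> -[a [b [sa tb ab]]]; exists a, b; split=> //; apply/IHs || apply/IHt.
- by split=> -[a [b [sa tb ab]]]; exists a, b; split=> //; apply/IHs || apply/IHt.
- by rewrite IH.
- by rewrite IHg IHh.
- by rewrite IHg IHh.
- by split=> -[a [aD ga]]; exists a; move: ga; rewrite IH scons_ren.
Qed.

Lemma val_shift e t a b : val (b .: e) ↑t a <-> val e t a.
Proof. by rewrite val_holds_ren.1. Qed.

Hypothesis str : structure.

Lemma val_E e t a b : val e t a -> E a b -> val e t b.
Proof.
have [_ sym trans cI cD _ _ _ _ _] := str.
case: t => /= [n|| f] ea ab; [exact: trans (sym _ _ ab) ea..|].
case: ea => aD aP; split=> [|c cD']; first exact: cD ab aD.
by rewrite -aP //; split; apply: cI => //; [exact: E_refl | exact: sym | exact: E_refl].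
Qed.

Lemma val_inj e t a b : val e t a -> val e t b -> E a b.
Proof.
have [_ sym trans _ _ _ ext _ _ _] := str.
case: t => /= [n|| f] ea eb; [exact: trans ea (sym _ _ eb)..|].
case: ea eb => [aD aP] [bD bP]; apply: ext => // c cD.
by rewrite aP // bP.
Qed.

Lemma val_D e t a : (forall n, D (e n)) -> val e t a -> D a.
Proof.
move=> eD; have DE := D_congr str; have sym := E_sym str; have hD := D_h str.
by case: t => /= [n /sym /DE|/sym /DE|f []]; auto.
Qed.

(** The values of the substituted terms are given as data, in [e'], because a term can fail to have
    a value in a structure. *)
Lemma val_holds_subst :
  (forall t e e' s a, (forall n, val e (s n) (e' n)) ->
    (val e (subst_t s t) a <-> val e' t a)) /\
  (forall f e e' s, (forall n, val e (s n) (e' n)) ->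
    (holds e (subst_f s f) <-> holds e' f)).
Proof.
have upP e e' s b : (forall n, val e (s n) (e' n)) ->
    forall n, val (b .: e) (up s n) ((b .: e') n).
  by move=> se [|n] /=; [apply: E_refl | apply/val_shift].
apply: syntax_ind => /= [n e e' s a||f IH e e' s a|s IHs t IHt e e' r
  |s IHs t IHt e e' r|g IH|g IHg h' IHh|g IHg h' IHh|g IH e e' s] se //.
- by split=> [/val_inj|/(E_sym str) /val_E]; apply.
- by split=> -[aD aP]; split=> // b bD; rewrite aP // IH; eauto.
- by split=> -[a [b [sa tb ab]]]; exists a, b; split=> //;
     first [apply/IHs | apply/IHt]; eauto.
- by split=> -[a [b [sa tb ab]]]; exists a, b; split=> //;
     first [apply/IHs | apply/IHt]; eauto.
- by move=> *; rewrite IH; eauto.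
- by move=> *; rewrite IHg ?IHh; eauto.
- by move=> *; rewrite IHg ?IHh; eauto.
- split=> -[a [aD ga]]; exists a; split=> //; apply/IH; eauto.
Qed.

Lemma holds_inst e f u a : val e u a -> (holds e (inst_f f u) <-> holds (a .: e) f).
Proof. by move=> ua; apply: val_holds_subst.2 => -[|n] //=; apply: E_refl. Qed.

(** A variable has its value only up to [E], so [e'] is a family of values under [e] for the
    identity substitution. *)
Lemma holds_congr e e' f : (forall n, E (e n) (e' n)) -> (holds e f <-> holds e' f).
Proof.
move=> ee; have := @val_holds_subst.2 f e e' Var.
by rewrite -[subst_f Var f](ren_as_subst.2 f id) ren_id.2; apply=> n /=; apply: E_sym.
Qed.

Lemma holds_Mem e s t a b : val e s a -> val e t b -> (holds e (s ∈ t) <-> I a b).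
Proof.
move=> sa tb; split=> [[c [d [sc td]]]|]; last by exists a, b.
by apply: I_congr => //; [exact: val_inj sc sa | exact: val_inj td tb].
Qed.

Lemma holds_Equ e s t a b : val e s a -> val e t b -> (holds e (s ≐ t) <-> E a b).
Proof.
move=> sa tb; split=> [[c [d [sc td cd]]]|]; last by exists a, b.
apply: E_trans (val_inj sa sc) _ => //.
by apply: E_trans cd (val_inj td tb).
Qed.

Lemma val_Var e n : val e #n (e n).
Proof. exact: E_refl. Qed.

Lemma holds_All e f : holds e (All f) <-> forall a, D a -> holds (a .: e) f.
Proof.
split=> [/= nf a aD|af /= [a [aD]]]; last by apply; apply: af.
by apply: NNPP => fa; apply: nf; exists a.
Qed.

Lemma holds_Imp e f g : holds e (f ⇒ g) <-> (holds e f -> holds e g).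
Proof. by split=> [[]|/imply_to_or]. Qed.

Lemma holds_Iff e f g : holds e (f ⇔ g) <-> (holds e f <-> holds e g).
Proof.
split=> [[/holds_Imp fg /holds_Imp gf]|[fg gf]]; first by split.
by split; apply/holds_Imp.
Qed.

Lemma holds_AllIn e t f : holds e (AllIn t f) <->
  forall a, D a -> holds (a .: e) (#0 ∈ ↑t) -> holds (a .: e) f.
Proof.
split=> [nf a aD ta|af [a [aD [ta]]]]; last by apply; apply: af.
by apply: NNPP => fa; apply: nf; exists a.
Qed.

End Semantics.

(** * Derived rules *)

Lemma axiom_ren r f : axiom f -> axiom (ren_f r f).
Proof.
case=> [|g gs||| ]; try by [apply: ax_ext | apply: ax_HF_empty | apply: ax_HF_adj | apply: ax_HF_ind].
have := ax_compr (safe_up_ren r gs); congr axiom.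
by rewrite -[Abs _]/(ren_t r (Abs g)) ren_tC.
Qed.

(** Renaming and weakening share one induction. Requiring only that the renamed hypotheses lie in
    [G'] treats uniformly the rules that add a hypothesis and [prv_ExE], which also shifts the
    others. *)
Lemma prv_ren_incl G f : prv G f -> forall (r : nat -> nat) G', injective r ->
  (forall g, List.In g G -> List.In (ren_f r g) G') -> prv G' (ren_f r f).
Proof.
have ext g H r G' : (forall g, List.In g H -> List.In (ren_f r g) G') ->
    forall g', List.In g' (g :: H) -> List.In (ren_f r g') (ren_f r g :: G').
  by move=> GG' g' /= [->|/GG']; auto.
move=> Gf; elim: G f / Gf => [G f fA|G f fw fG|G f g fw _ IH1 _ IH2|G f _ IH|G f g _ IHf _ IHg
  |G f g _ IH|G f g _ IH|G f g gw _ IH|G f g fw _ IH|G f g k _ IH _ IHf _ IHg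
  |G f t fw tw _ IH|G f g _ IH _ IHg|G t tw|G f s t fw _ IHe _ IH] r G' rI GG'.
- by apply: prv_ax; apply: axiom_ren.
- by apply: prv_hyp; [apply: wf_f_ren | apply: GG'].
- by apply: (@prv_NegI _ _ (ren_f r g)); [apply: wf_f_ren | apply: IH1 | apply: IH2]; eauto.
- by apply: prv_NegNegE; apply: IH.
- by apply: prv_AndI; [apply: IHf | apply: IHg].
- by apply: prv_AndE1; apply: IH.
- by apply: prv_AndE2; apply: IH.
- by apply: prv_OrI1; [apply: wf_f_ren | apply: IH].
- by apply: prv_OrI2; [apply: wf_f_ren | apply: IH].
- by apply: prv_OrE; [apply: IH | apply: IHf | apply: IHg]; eauto.
- apply: (@prv_ExI _ _ (ren_t r t)); [exact: wf_f_ren | exact: wf_t_ren|].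
  by rewrite -ren_inst; apply: IH.
- apply: prv_ExE (IH _ _ rI GG') _; rewrite ren_fC; apply: IHg => [|g'].
    exact: up_ren_inj.
  move=> /= [<-|/List.in_map_iff [k [<- kG]]]; [by left | right].
  rewrite -ren_fC.
  by apply/List.in_map; apply: GG'.
- by apply: prv_EquI; apply: wf_t_ren.
- rewrite ren_inst; apply: (@prv_EquE _ _ (ren_t r s)); first exact: wf_f_ren.
    exact: IHe.
  by rewrite -ren_inst; apply: IH.
Qed.

Lemma prv_weaken G G' f : List.incl G G' -> prv G f -> prv G' f.
Proof.
move=> GG' Gf; rewrite -[f]ren_id.2; apply: prv_ren_incl Gf _ _ _ _ => // g.
by rewrite ren_id.2; apply: GG'.
Qed.

(** Eliminating [f ∨ f] with the same derivation in both branches performs the cut. *)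
Lemma prv_cut G f g : wf_f f -> prv G f -> prv (f :: G) g -> prv G g.
Proof. by move=> fw Gf fg; apply: (prv_OrE _ fg fg); apply: prv_OrI1. Qed.

Lemma prv_cuts L G g : (forall f, List.In f L -> wf_f f /\ prv G f) ->
  prv (L ++ G) g -> prv G g.
Proof.
elim: L => //= f L IH LG fg; apply: IH => [f' f'L|]; first by apply: LG; right.
have [fw Gf] := LG f (or_introl erefl).
apply: prv_cut fw _ fg; apply: prv_weaken Gf => x.
by rewrite List.in_app_iff; right.
Qed.

Lemma prv_explode G f g : wf_f g -> prv G f -> prv G (¬ f) -> prv G g.
Proof.
have tl : List.incl G ((¬ g) :: G) by move=> x; right.
move=> gw Gf nf; apply: prv_NegNegE; apply: (@prv_NegI _ _ f) => //.
  exact: prv_weaken Gf.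
exact: prv_weaken nf.
Qed.

Lemma prv_Equ_sym G s t : wf_t s -> prv G (s ≐ t) -> prv G (t ≐ s).
Proof.
move=> sw st; rewrite -[s in _ ≐ s](inst_shift_t s t).
apply: (@prv_EquE _ (#0 ≐ ↑s) s) => //.
  by split; [constructor | apply: wf_shift].
by rewrite /inst_f /= -/(inst_t _ _) inst_shift_t; apply: prv_EquI.
Qed.

Lemma prv_Equ_trans G s t u : wf_t s -> prv G (s ≐ t) -> prv G (t ≐ u) -> prv G (s ≐ u).
Proof.
move=> sw st tu; rewrite -[s in s ≐ _](inst_shift_t s u).
apply: (@prv_EquE _ (↑s ≐ #0) t) => //.
  by split; [apply: wf_shift | constructor].
by rewrite /inst_f /= -/(inst_t _ _) inst_shift_t.
Qed.

Lemma prv_Mem_congr G s t s' t' : wf_t s' -> wf_t t ->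
  prv G (s ≐ s') -> prv G (t ≐ t') -> prv G (s ∈ t) -> prv G (s' ∈ t').
Proof.
move=> s'w tw ss' tt' st; have : prv G (s' ∈ t).
  rewrite -[t](inst_shift_t t s'); apply: (@prv_EquE _ (#0 ∈ ↑t) s) => //.
    by split; [constructor | apply: wf_shift].
  by rewrite /inst_f /= -/(inst_t _ _) inst_shift_t.
move=> {}st; rewrite -[s'](inst_shift_t s' t').
apply: (@prv_EquE _ (↑s' ∈ #0) t) => //.
  by split; [apply: wf_shift | constructor].
by rewrite /inst_f /= -/(inst_t _ _) inst_shift_t.
Qed.

(** * Henkin theories *)

(** The syntax has no falsum. This refutable formula is legal and contains no variable, so every
    renaming fixes it and it can be the conclusion of [prv_ExE] unchanged. *)
Definition bot : form := ¬ HF ≐ HF.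

Record henkin (Th : form -> Prop) : Prop := Henkin {
  Th_prv : forall L g, (forall f, List.In f L -> wf_f f /\ Th f) -> prv L g -> Th g;
  Th_Neg : forall f, wf_f f -> (Th (¬ f) <-> ~ Th f);
  Th_witness : forall g, wf_f g -> Th (Ex g) -> exists k, Th (inst_f g #k)
}.

(** [GenTree.tree nat] is countable, which yields a numbering of formulas. Tags are reused between
    terms and formulas, whose codes are never compared with each other. *)
Fixpoint enc_t (t : term) : GenTree.tree nat :=
  match t with
  | Var n => GenTree.Node 0 [:: GenTree.Leaf n]
  | HF => GenTree.Node 1 [::]
  | Abs f => GenTree.Node 2 [:: enc_f f]
  end
with enc_f (f : form) : GenTree.tree nat :=
  match f with
  | Mem s t => GenTree.Node 0 [:: enc_t s; enc_t t]
  | Equ s t => GenTree.Node 1 [:: enc_t s; enc_t t]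
  | Neg g => GenTree.Node 2 [:: enc_f g]
  | And g h => GenTree.Node 3 [:: enc_f g; enc_f h]
  | Or g h => GenTree.Node 4 [:: enc_f g; enc_f h]
  | Ex g => GenTree.Node 5 [:: enc_f g]
  end.

Lemma enc_inj : injective enc_t /\ injective enc_f.
Proof.
suff: (forall t t', enc_t t = enc_t t' -> t = t') /\
      (forall f f', enc_f f = enc_f f' -> f = f').
  by case=> ? ?; split=> ? ?; auto.
apply: syntax_ind => /= [n|| f IH|s IHs t IHt|s IHs t IHt|g IH|g IHg h IHh
  |g IHg h IHh|g IH] [] //=.
- by move=> ? [->].
- by move=> ? [/IH ->].
- by move=> ? ? [/IHs -> /IHt ->].
- by move=> ? ? [/IHs -> /IHt ->].
- by move=> ? [/IH ->].
- by move=> ? ? [/IHg -> /IHh ->].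
- by move=> ? ? [/IHg -> /IHh ->].
- by move=> ? [/IH ->].
Qed.

(** Only surjectivity matters, so a number that codes no formula gets whatever [epsilon] returns. *)
Definition enum_form (n : nat) : form :=
  epsilon (inhabits bot) (fun f => choice.pickle (enc_f f) = n).

Lemma enum_formP f : exists n, enum_form n = f.
Proof.
exists (choice.pickle (enc_f f)); apply: enc_inj.2.
apply: (pcan_inj (@choice.pickleK (GenTree.tree nat))).
by apply: (epsilon_spec (inhabits bot) (fun g => choice.pickle (enc_f g) = choice.pickle (enc_f f))); exists f.
Qed.

(** Not lowered at binders: an overestimate is enough to find a variable outside a finite list. *)
Fixpoint bound_t (t : term) : nat :=
  match t with Var n => n.+1 | HF => 0 | Abs f => bound_f f end
with bound_f (f : form) : nat :=
  match f with
  | Mem s t | Equ s t => maxn (bound_t s) (bound_t t)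
  | Neg g | Ex g => bound_f g
  | And g h | Or g h => maxn (bound_f g) (bound_f h)
  end.

Lemma fv_bound :
  (forall t n, fv_t n t -> n < bound_t t) /\ (forall f n, fv_f n f -> n < bound_f f).
Proof.
apply: syntax_ind => //= [n m /eqP -> //|f IH n|s IHs t IHt n|s IHs t IHt n
  |g IHg h IHh n|g IHg h IHh n|g IH n].
- by move/IH; apply: ltn_trans.
- by rewrite leq_max => /orP [/IHs ->|/IHt ->]; rewrite ?orbT.
- by rewrite leq_max => /orP [/IHs ->|/IHt ->]; rewrite ?orbT.
- by rewrite leq_max => /orP [/IHg ->|/IHh ->]; rewrite ?orbT.
- by rewrite leq_max => /orP [/IHg ->|/IHh ->]; rewrite ?orbT.
- by move/IH; apply: ltn_trans.
Qed.

Definition fresh (G : seq form) : nat := \max_(f <- G) bound_f f.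

Lemma freshP G f : List.In f G -> ~~ fv_f (fresh G) f.
Proof.
rewrite /fresh => fG; apply/negP => /fv_bound.2; apply/negP; rewrite -leqNgt.
elim: G fG => //= g G IH [->|/IH fG]; rewrite big_cons leq_max ?leqnn // fG orbT.
by [].
Qed.

Lemma ren_agree :
  (forall t r s, (forall n, fv_t n t -> r n = s n) -> ren_t r t = ren_t s t) /\
  (forall f r s, (forall n, fv_f n f -> r n = s n) -> ren_f r f = ren_f s f).
Proof.
apply: syntax_ind => //= [n|f IH|s IHs t IHt|s IHs t IHt|g IH|g IHg h IHh
  |g IHg h IHh|g IH] r r' rr.
- by rewrite rr.
- by rewrite (IH (up_ren r) (up_ren r')) // => -[|n] //= /rr ->.
- by rewrite (IHs r r') ?(IHt r r') // => n nf; apply: rr; rewrite nf ?orbT.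
- by rewrite (IHs r r') ?(IHt r r') // => n nf; apply: rr; rewrite nf ?orbT.
- by rewrite (IH r r').
- by rewrite (IHg r r') ?(IHh r r') // => n nf; apply: rr; rewrite nf ?orbT.
- by rewrite (IHg r r') ?(IHh r r') // => n nf; apply: rr; rewrite nf ?orbT.
- by rewrite (IH (up_ren r) (up_ren r')) // => -[|n] //= /rr ->.
Qed.

(* Renaming the fresh variable to 0 and shifting the others turns a proof from an
   instance into a proof from the eigenvariable. *)
Lemma prv_witness G g k : wf_f g -> (forall f, List.In f (Ex g :: G) -> ~~ fv_f k f) ->
  prv (inst_f g #k :: Ex g :: G) bot -> prv (Ex g :: G) bot.
Proof.
move=> gw kG kbot; apply: (@prv_ExE _ g); first by apply: prv_hyp => //; left.
pose r n := if n == k then 0 else n.+1.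
have rI : injective r by move=> m n; rewrite /r; do 2 case: eqP => [->|?]; congruence.
apply: prv_ren_incl kbot _ _ rI _ => f [<-|fG]; last first.
  right; have -> : ren_f r f = ren_f succn f.
    apply: ren_agree.2 => n nf; rewrite /r; case: eqP nf => // ->.
    by rewrite (negPf (kG _ fG)).
  exact: (@List.in_map _ _ (ren_f succn) (Ex g :: G) f fG).
(* Index 0 goes to [k] and then to 0, index [n.+1] to [n] and back; so the composite is the identity
   on the free variables of [g], among which [k.+1] does not occur. *)
left; rewrite inst_var ren_comp.2 -[LHS]ren_id.2; apply: ren_agree.2.
move=> [|n] /= nf; first by rewrite /r eqxx.
rewrite /r; case: eqP nf => // ->.
by have /= /negPf -> := kG _ (or_introl erefl).
Qed.

Definition consistent (G : seq form) : Prop := ~ prv G bot.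

(** The witness enters together with its existential formula, so no later stage has to return to it.
    Illegal formulas are left out because [prv_hyp] cannot use them. *)
Definition henkin_step (f : form) (G : seq form) : seq form :=
  if excluded_middle_informative (wf_f f /\ consistent (f :: G)) then
    if f is Ex g then inst_f g #(fresh (f :: G)) :: f :: G else f :: G
  else G.

Fixpoint henkin_stage (G : seq form) (n : nat) : seq form :=
  if n is m.+1 then henkin_step (enum_form m) (henkin_stage G m) else G.

Lemma henkin_step_incl f G : List.incl G (henkin_step f G).
Proof.
rewrite /henkin_step; case: excluded_middle_informative => /= [_|_] g gG //.
by case: f => *; do ?right.
Qed.

Lemma henkin_step_consistent f G : consistent G -> consistent (henkin_step f G).
Proof.
rewrite /henkin_step; case: excluded_middle_informative => //= -[fw fc] _.
case: f fw fc => // g gw gc kbot; apply: gc.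
by apply: (prv_witness (g := g)) kbot => // f; apply: freshP.
Qed.

Lemma henkin_stage_incl G m n : m <= n ->
  List.incl (henkin_stage G m) (henkin_stage G n).
Proof.
move=> /subnK <-; elim: (n - m) => [|k IH]; first by move=> ?.
by move=> f /IH; apply: henkin_step_incl.
Qed.

(** The theory consists of what some stage derives. Stages increase and stay consistent; a formula
    is decided at the stage that examines it, and closure under derivation holds because finitely
    many hypotheses are available at a common stage. *)
Lemma henkin_extension G : consistent G ->
  exists Th, henkin Th /\ forall f, wf_f f -> List.In f G -> Th f.
Proof.
move=> Gc; pose S := henkin_stage G; pose Th f := exists n, prv (S n) f.
have Sc n : consistent (S n) by elim: n => //= n; apply: henkin_step_consistent.
have ThS f m n : m <= n -> prv (S m) f -> prv (S n) f.
  by move=> mn; apply: prv_weaken; apply: henkin_stage_incl.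
have botE H f : prv H f -> prv H (¬ f) -> prv H bot.
  by apply: prv_explode; split; constructor.
(* If [f] is refused at its stage, that stage with [f] derives [bot], hence the stage derives [¬ f].
   So a legal formula whose negation is never derived gets accepted, along with a witness. *)
have mem f : wf_f f -> ~ Th (¬ f) ->
    exists n, List.In f (S n) /\ forall g, f = Ex g -> exists k, List.In (inst_f g #k) (S n).
  move=> fw nf; have [n En] := enum_formP f; exists n.+1.
  rewrite /S /= En /henkin_step; case: excluded_middle_informative => /= [_|].
    split=> [|g ->]; last by eexists; left.
    by case: (f) => *; do ?[by left | right].
  case; split=> // fbot; apply: nf; exists n.
  apply: (@prv_NegI _ _ (HF ≐ HF)) => //.
  by apply: prv_EquI; constructor.
have neg f : wf_f f -> (Th (¬ f) <-> ~ Th f).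
  move=> fw; split=> [[m nf] [n pf]|nf].
    apply: (Sc (maxn m n)); apply: botE (ThS _ _ _ _ pf) (ThS _ _ _ _ nf).
      exact: leq_maxr.
    exact: leq_maxl.
  apply: NNPP => nnf; have [n [fn _]] := mem _ fw nnf.
  by apply: nf; exists n; apply: prv_hyp.
exists Th; split; last by move=> f fw fG; exists 0; apply: prv_hyp.
split=> // [L g LT Lg|g gw gT].
  suff [n Ln] : exists n, forall f, List.In f L -> wf_f f /\ prv (S n) f.
    exists n; apply: (prv_cuts Ln); apply: prv_weaken Lg => f.
    by rewrite List.in_app_iff; left.
  elim: L LT {Lg} => [|f L IH] LT; first by exists 0.
  have [m Lm] := IH (fun g gL => LT g (or_intror gL)).
  have [fw [n fn]] := LT f (or_introl erefl); exists (maxn m n) => f' [<-|f'L].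
    by split=> //; apply: ThS fn; apply: leq_maxr.
  have [f'w f'm] := Lm _ f'L; split=> //; apply: ThS f'm; apply: leq_maxl.
have [|n [_ /(_ g erefl) [k kn]]] := mem (Ex g) gw; first by move/neg; apply.
by exists k, n; apply: prv_hyp => //; apply: wf_inst => //; constructor.
Qed.

Section HenkinModel.
Variable Th : form -> Prop.
Hypothesis Th_henkin : henkin Th.

Lemma Th_prv1 f g : wf_f f -> Th f -> prv [:: f] g -> Th g.
Proof. by move=> fw fT; apply: (Th_prv Th_henkin) => f' [<-|[]]. Qed.

Lemma Th_prv2 f g k : wf_f f -> Th f -> wf_f g -> Th g -> prv [:: f; g] k -> Th k.
Proof. by move=> fw fT gw gT; apply: (Th_prv Th_henkin) => f' [<-|[<-|[]]]. Qed.

Lemma Th_provable f : provable f -> Th f.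
Proof. by apply: (Th_prv Th_henkin). Qed.

Lemma Th_And f g : wf_f f -> wf_f g -> (Th (f ∧ g) <-> Th f /\ Th g).
Proof.
move=> fw gw; have fgw : wf_f (f ∧ g) by [].
have hyp : prv [:: f ∧ g] (f ∧ g) by apply: prv_hyp => //; left.
split=> [fg|[fT gT]].
  by split; apply: (Th_prv1 fgw fg); [apply: prv_AndE1 hyp | apply: prv_AndE2 hyp].
apply: (Th_prv2 fw fT gw gT); apply: prv_AndI; apply: prv_hyp => //; first by left.
by right; left.
Qed.

Lemma Th_Or f g : wf_f f -> wf_f g -> (Th (f ∨ g) <-> Th f \/ Th g).
Proof.
move=> fw gw; have fgw : wf_f (f ∨ g) by [].
split=> [fg|[fT|gT]].
- apply: NNPP => nfg; have nf : Th (¬ f).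
    by rewrite (Th_Neg Th_henkin) // => fT; apply: nfg; left.
  suff : Th g by move=> ?; apply: nfg; right.
  apply: (Th_prv2 fgw fg (fw : wf_f (¬ f)) nf).
  apply: (@prv_OrE _ f g); first by apply: prv_hyp => //; left.
    apply: (@prv_explode _ f) => //; apply: prv_hyp => //; first by left.
    by right; right; left.
  by apply: prv_hyp => //; left.
- by apply: (Th_prv1 fw fT); apply: prv_OrI1 => //; apply: prv_hyp => //; left.
- by apply: (Th_prv1 gw gT); apply: prv_OrI2 => //; apply: prv_hyp => //; left.
Qed.

Lemma Th_Ex g : wf_f g -> (Th (Ex g) <-> exists k, Th (ren_f (k .: id) g)).
Proof.
move=> gw; split=> [/(Th_witness Th_henkin gw) [k]|[k gk]].
  by rewrite inst_var; exists k.
apply: (Th_prv1 _ gk); first exact: wf_f_ren.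
apply: (@prv_ExI _ _ #k) => //; first by constructor.
by rewrite inst_var; apply: prv_hyp; [apply: wf_f_ren | left].
Qed.

Lemma Th_All g : wf_f g -> (Th (All g) <-> forall k, Th (ren_f (k .: id) g)).
Proof.
move=> gw; rewrite (Th_Neg Th_henkin) // Th_Ex //=; split=> [ng k|ag [k]].
  apply: NNPP => ngk; apply: ng; exists k.
  by apply/(Th_Neg Th_henkin); first exact: wf_f_ren.
by move/(Th_Neg Th_henkin); apply=> //; apply: wf_f_ren.
Qed.

Lemma Th_Imp f g : wf_f f -> wf_f g -> (Th (f ⇒ g) <-> (Th f -> Th g)).
Proof.
move=> fw gw; rewrite Th_Or // (Th_Neg Th_henkin) //.
by split=> [[]|/imply_to_or].
Qed.

Lemma Th_Iff f g : wf_f f -> wf_f g -> (Th (f ⇔ g) <-> (Th f <-> Th g)).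
Proof. by move=> fw gw; rewrite Th_And // !Th_Imp. Qed.

Lemma Th_refl t : wf_t t -> Th (t ≐ t).
Proof. by move=> tw; apply: Th_provable; apply: prv_EquI. Qed.

Lemma Th_sym s t : wf_t s -> wf_t t -> Th (s ≐ t) -> Th (t ≐ s).
Proof.
move=> sw tw st; apply: (Th_prv1 _ st) => //.
by apply: prv_Equ_sym => //; apply: prv_hyp => //; left.
Qed.

Lemma Th_trans s t u : wf_t s -> wf_t t -> wf_t u ->
  Th (s ≐ t) -> Th (t ≐ u) -> Th (s ≐ u).
Proof.
move=> sw tw uw st tu; apply: (Th_prv2 _ st _ tu) => //.
by apply: (prv_Equ_trans (t := t)) => //; apply: prv_hyp => //; [left | right; left].
Qed.

Lemma Th_Mem_congr s t s' t' : wf_t s -> wf_t t -> wf_t s' -> wf_t t' ->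
  Th (s ≐ s') -> Th (t ≐ t') -> Th (s ∈ t) -> Th (s' ∈ t').
Proof.
move=> sw tw s'w t'w ss' tt' st.
apply: (Th_prv Th_henkin (L := [:: s ≐ s'; t ≐ t'; s ∈ t])).
  by move=> f' [<-|[<-|[<-|[]]]].
by apply: (@prv_Mem_congr _ s t) => //; apply: prv_hyp => //; [left | right; left
  | right; right; left].
Qed.

(** Reflexivity proves that something equals [t], and the Henkin witness for this is a variable.
    This is why the variables alone can form the model. *)
Lemma Th_named t : wf_t t -> exists k, Th (#k ≐ t).
Proof.
move=> tw; have V n : wf_t #n by constructor.
have /Th_Ex [] : Th (Ex (#0 ≐ ↑t)).
- apply: Th_provable; apply: (@prv_ExI _ _ t) => //=.
    by split=> //; apply: wf_shift.
  by rewrite /inst_f /= -/(inst_t _ _) inst_shift_t; apply: prv_EquI.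
- by split=> //; apply: wf_shift.
by move=> k /=; rewrite ren_scons_shift ren_id.1; exists k.
Qed.

Lemma Th_compr f k : safe f [fset 0%N]%fset ->
  (Th (#k ∈ Abs f) <-> Th (ren_f (k .: id) f)).
Proof.
move=> fs; have fw := safe_wf fs.
have V n : wf_t #n by constructor.
have Aw : wf_t ↑(Abs f) by apply/wf_shift; constructor.
have := Th_provable (prv_ax [::] (ax_compr fs)).
rewrite Th_All //= => /(_ k) /=.
rewrite -[Abs _]/(ren_t (k .: id) ↑(Abs f)) ren_scons_shift ren_id.1.
by move/Th_Iff; apply; [split=> //; constructor | apply: wf_f_ren].
Qed.

Lemma Th_ext s t : wf_t s -> wf_t t ->
  (forall c, Th (#c ∈ s) <-> Th (#c ∈ t)) -> Th (s ≐ t).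
Proof.
have V n : wf_t #n by constructor.
move=> sw tw st; have [a sa] := Th_named sw; have [b tb] := Th_named tw.
have := Th_provable (prv_ax [::] ax_ext).
rewrite Th_All //= => /(_ a) /=; rewrite Th_All //= => /(_ b) /=.
rewrite Th_Imp //= => ab.
suff : Th (#a ≐ #b).
  by move=> e; apply: Th_trans (Th_trans _ _ _ (Th_sym _ _ sa) e) tb.
apply: ab; rewrite Th_All //= => c; rewrite Th_Iff //=.
have sa' c' : Th (#c' ∈ #a) <-> Th (#c' ∈ s).
  by split; apply: Th_Mem_congr => //; try exact: Th_refl; apply: Th_sym.
have tb' c' : Th (#c' ∈ #b) <-> Th (#c' ∈ t).
  by split; apply: Th_Mem_congr => //; try exact: Th_refl; apply: Th_sym.
by rewrite sa' tb'.
Qed.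

Variable h : nat.
Hypothesis Th_h : Th (#h ≐ HF).

Let T (_ : nat) := True.
Let eqn a b := Th (#a ≐ #b).
Let inn a b := Th (#a ∈ #b).

(** Elements are variables, so an assignment is a renaming. Legality enters at abstractions:
    comprehension turns membership in the renamed term into truth of the body, and extensionality
    recovers the term from its elements. *)
Lemma henkin_truth :
  (forall t, wf_t t -> forall e a, val T eqn inn h e t a <-> Th (#a ≐ ren_t e t)) /\
  (forall f, wf_f f -> forall e, holds T eqn inn h e f <-> Th (ren_f e f)).
Proof.
have V n : wf_t #n by constructor.
have W t r : wf_t t -> wf_t (ren_t r t) by exact: wf_t_ren.
have WF f r : wf_f f -> wf_f (ren_f r f) by exact: wf_f_ren.
apply: syntax_ind => /= [n _ e a||f IH fw e a|s IHs t IHt [sw tw] e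
  |s IHs t IHt [sw tw] e|g IH gw e|g IHg h' IHh [gw hw] e|g IHg h' IHh [gw hw] e
  |g IH gw e] //.
- by move=> Hw e a; split=> ah; apply: Th_trans ah _ => //; apply: Th_sym.
- have fs : safe f [fset 0%N]%fset by inversion fw.
  have fs' := safe_up_ren e fs.
  have Aw : wf_t (Abs (ren_f (up_ren e) f)) by constructor.
  have comp b : holds T eqn inn h (b .: e) f <-> Th (#b ∈ Abs (ren_f (up_ren e) f)).
    rewrite (IH (safe_wf fs)) (Th_compr _ fs') ren_comp.2.
    suff -> : (b .: id) \o up_ren e = b .: e by [].
    by apply: functional_extensionality => -[].
  split=> [[_ aP]|aA].
    by apply: Th_ext => // c; rewrite -comp -aP.
  split=> // b _; rewrite comp; split; apply: Th_Mem_congr => //; try exact: Th_refl.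
  exact: Th_sym.
- split=> [[a [b [/IHs sa /IHt tb ab]]]|st].
    by apply: Th_Mem_congr ab; auto; apply: Th_sym; auto.
  have [a sa] := Th_named (W _ e sw); have [b tb] := Th_named (W _ e tw).
  exists a, b; split; [exact/IHs | exact/IHt|].
  by apply: Th_Mem_congr st; auto; apply: Th_sym; auto.
- split=> [[a [b [/IHs sa /IHt tb ab]]]|st].
    apply: Th_trans (Th_trans _ _ _ (Th_sym _ _ (sa _)) ab) (tb _); auto.
  have [a sa] := Th_named (W _ e sw); have [b tb] := Th_named (W _ e tw).
  exists a, b; split; [exact/IHs | exact/IHt|].
  by apply: Th_trans (Th_trans _ _ _ sa st) (Th_sym _ _ tb); auto.
- by rewrite IH // (Th_Neg Th_henkin); auto.
- by rewrite IHg // IHh // Th_And; auto.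
- by rewrite IHg // IHh // Th_Or; auto.
- rewrite Th_Ex; last exact: WF.
  have E k : ren_f (k .: id) (ren_f (up_ren e) g) = ren_f (k .: e) g.
    rewrite ren_comp.2; congr ren_f.
    by apply: functional_extensionality => -[].
  by split=> [[k [_ gk]]|[k gk]]; exists k; [rewrite E -IH | rewrite IH // -E].
Qed.

Lemma henkin_structure : structure T eqn inn h.
Proof.
have V n : wf_t #n by constructor.
have named t e : wf_t t -> exists a, val T eqn inn h e t a.
  move=> tw; have [k tk] := Th_named (wf_t_ren e tw).
  by exists k; apply/henkin_truth.1.
have eqE u v : (exists a b, [/\ eqn a u, eqn b v & eqn a b]) <-> eqn u v.
  split=> [[a [b [au bv ab]]]|uv].
    exact: Th_trans (Th_trans _ _ _ (Th_sym _ _ au) ab) bv.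
  by exists u, v; split=> //; apply: Th_refl.
have memE u v : (exists a b, [/\ eqn a u, eqn b v & inn a b]) <-> inn u v.
  split=> [[a [b [au bv ab]]]|uv]; first exact: Th_Mem_congr au bv ab.
  by exists u, v; split=> //; apply: Th_refl.
split=> //.
- by move=> a; apply: Th_refl.
- by move=> a b; apply: Th_sym.
- by move=> a b c; apply: Th_trans.
- by move=> a b c d; apply: Th_Mem_congr.
- by move=> a b _ _ ab; apply: Th_ext => // c; apply: ab.
- have [a [_ aP]] := named empty id wf_empty; exists a; split=> // b _ ba.
  by case: ((aP b Logic.I).1 ba); exists b, b; split; apply: Th_refl.
- move=> a b _ _.
  have [c [_ cP]] := named (upair #0 #1) (a .: b .: id) (wf_upair (V _) (V _)).
  by exists c; split=> // d _; rewrite cP //= !eqE.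
- move=> a _; have [c [_ cP]] := named (big_cup #0) (a .: id) (wf_big_cup (V _)).
  exists c; split=> // d _; rewrite cP //=; split=> [[b [_ []]]|[b [_ ba db]]].
    by rewrite !memE => ba db; exists b.
  by exists b; split=> //; rewrite !memE.
Qed.
End HenkinModel.

(** If [f] were not derivable, a Henkin theory would contain [¬ f]; under the identity assignment
    its model would put [f] in the theory too. The premise ranges over all structures, more than the
    models of the theory, and so is stronger than semantic consequence. *)
Lemma completeness f : wf_f f ->
  (forall (M : Type) D E I (h : M), structure D E I h ->
    forall e, (forall n, D (e n)) -> holds D E I h e f) -> provable f.
Proof.
move=> fw fM; apply: NNPP => nf.
have [|Th [TH Thf]] := @henkin_extension [:: ¬ f].
  move=> fbot; apply: nf; apply: prv_NegNegE.
  apply: (@prv_NegI _ _ (HF ≐ HF)) => //.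
  by apply: prv_EquI; constructor.
have [h hP] := Th_named TH wf_HF.
have := fM _ _ _ _ _ (henkin_structure TH hP) id (fun _ => Logic.I).
rewrite (henkin_truth TH hP).2 // ren_id.2 => fT.
by have /(Th_Neg TH) := Thf (¬ f) fw (or_introl erefl); apply.
Qed.

(** * Suprema in an arbitrary structure *)

(** Which variables occur is settled here by computation, while [QQ] and [ltQ] can still be
    unfolded, and is phrased as invariance under renaming, the form that [holds_tail] takes. *)
Lemma ren_QQ r : ren_t r QQ = QQ.
Proof. by []. Qed.

Lemma ren_ltQ10 r : ren_f (0 .: 1 .: r) (ltQ #1 #0) = ltQ #1 #0.
Proof. by []. Qed.

Lemma ren_ltQ01 r : ren_f (0 .: 1 .: r) (ltQ #0 #1) = ltQ #0 #1.
Proof. by []. Qed.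

Lemma ren_RR r : ren_f (0 .: r) RR = RR.
Proof. by []. Qed.

Local Opaque QQ ltQ.

Section Suprema.
Variables (M : Type) (D : M -> Prop) (E I : M -> M -> Prop) (h : M).
Hypothesis str : structure D E I h.

Notation val := (val D E I h).
Notation holds := (holds D E I h).

Let cst (_ : nat) : M := h.

(** A formula fixed by [r] sees an assignment only through its composite with [r]. Letting [r] send
    all indices beyond the free ones to 0 makes truth independent of the rest of the assignment. *)
Lemma holds_tail f r e e' : ren_f r f = f -> e \o r = e' \o r ->
  (holds e f <-> holds e' f).
Proof.
move=> fr ee; have H d : holds d f <-> holds (d \o r) f.
  by rewrite -{1}fr (val_holds_ren _ _ _ _).2.
by rewrite H ee -H.
Qed.

Lemma holds_MemV e m n : holds e (#m ∈ #n) <-> I (e m) (e n).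
Proof. exact: holds_Mem (val_Var str _ _) (val_Var str _ _). Qed.

Lemma holds_EquV e m n : holds e (#m ≐ #n) <-> E (e m) (e n).
Proof. exact: holds_Equ (val_Var str _ _) (val_Var str _ _). Qed.

Lemma holds_AllInV e n f : holds e (AllIn #n f) <->
  forall a, D a -> I a (e n) -> holds (a .: e) f.
Proof.
by rewrite holds_AllIn; split=> H a aD aI; apply: H => //;
  apply/(holds_MemV (a .: e) 0 n.+1).
Qed.

Lemma holds_ExInV e n f : holds e (ExIn #n f) <->
  exists a, [/\ D a, I a (e n) & holds (a .: e) f].
Proof.
have H a := holds_MemV (a .: e) 0 n.+1.
split=> [[a [aD [/H ae fa]]]|[a [aD ae fa]]]; exists a; split=> //.
by split=> //; apply/H.
Qed.

Definition sub (a b : M) : Prop := forall q, D q -> I q a -> I q b.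

Lemma holds_SubsetV e m n : holds e (Subset #m #n) <-> sub (e m) (e n).
Proof.
by rewrite holds_AllInV; split=> H a aD am; apply/(holds_MemV (a .: e) 0 n.+1)/H.
Qed.

Lemma sub_antisym a b : D a -> D b -> sub a b -> sub b a -> E a b.
Proof. by move=> aD bD ab ba; apply: (I_ext str) => // c cD; split; auto. Qed.

Lemma holds_nonempty e n : D (e n) ->
  (holds e (¬ #n ≐ empty) <-> exists q, D q /\ I q (e n)).
Proof.
move=> nD; have [z [zD zP]] := has_empty str.
have zv : val e empty z.
  split=> // b bD; split=> [/zP|[]]; first by case.
  exact/holds_EquV/(E_refl str).
rewrite /= -/(holds e (#n ≐ empty)) (holds_Equ str (val_Var str e n) zv).
split=> [nz|[q [qD qn]] nz].
  apply: NNPP => nq; apply: nz; apply: sub_antisym => // q qD; last by move/zP; case.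
  by move=> qn; case: nq; exists q.
by apply: (zP q qD); apply: (I_congr str) nz qn; apply: (E_refl str).
Qed.

Definition rational (q : M) : Prop := holds (q .: cst) (#0 ∈ QQ).
(** [before] and [beyond] are the one order [ltQ], first argument below second, at the two
    placements of indices found in [RR]; each placement is treated as a primitive of its own. *)
Definition before (q p : M) : Prop := holds (p .: q .: cst) (ltQ #1 #0).
Definition beyond (p g : M) : Prop := holds (p .: g .: cst) (ltQ #0 #1).

Definition cut (a : M) : Prop := holds (a .: cst) RR.

Lemma cut_tail a e : holds (a .: e) RR <-> cut a.
Proof.
apply: (holds_tail (ren_RR (fun _ => 0))).
by apply: functional_extensionality => -[].
Qed.

Lemma cut_congr a b : E a b -> (cut a <-> cut b).
Proof.
by move=> ab; apply: (holds_congr str) => -[|n] //=; apply: (E_refl str).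
Qed.

(* [QQ] and [ltQ] are left uninterpreted: [QQ] is not even assumed to have a
   value, whence the third clause. *)
Lemma cutP a : D a -> cut a <->
  [/\ forall q, D q -> I q a -> rational q, exists q, D q /\ I q a,
      ~ val cst QQ a,
      forall q, D q -> rational q -> forall p, D p -> I p a -> before q p -> I q a
    & ~ exists g, [/\ D g, I g a & forall p, D p -> I p a -> beyond p g \/ E p g]].
Proof.
move=> aD; set e := a .: cst.
have ratE q d : holds (q .: d) (#0 ∈ QQ) <-> rational q.
  have fr : ren_f (0 .: fun _ => 0) (#0 ∈ QQ) = (#0 ∈ QQ).
    by rewrite /= ren_QQ.
  by apply: (holds_tail fr); apply: functional_extensionality => -[].
have ltE1 q p : holds (p .: q .: e) (ltQ #1 #0) <-> before q p.
  apply: (holds_tail (ren_ltQ10 (fun _ => 0))).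
  by apply: functional_extensionality => -[|[]].
have ltE2 p g : holds (p .: g .: e) (ltQ #0 #1) <-> beyond p g.
  apply: (holds_tail (ren_ltQ01 (fun _ => 0))).
  by apply: functional_extensionality => -[|[]].
have H1 : holds e (Subset #0 QQ) <-> forall q, D q -> I q a -> rational q.
  rewrite holds_AllInV ren_QQ; split=> H q qD qa; first exact/(ratE q e)/H.
  exact/ratE/H.
have H2 := holds_nonempty (e := e) (n := 0) aD.
have H3 : holds e (¬ #0 ≐ QQ) <-> ~ val cst QQ a.
  have tl b : val e QQ b <-> val cst QQ b.
    by rewrite -{1}(ren_QQ succn) val_shift.
  suff H : holds e (#0 ≐ QQ) <-> val cst QQ a by split=> nH /H.
  split=> [[b [c [ba /tl cQ bc]]]|aQ].
    apply: (val_E str) cQ _; apply: (E_trans str) ba.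
    exact: (E_sym str).
  by exists a, a; split; [exact: val_Var | apply/tl | exact: (E_refl str)].
have H4 : holds e (AllIn QQ (AllIn #1 (ltQ #1 #0 ⇒ #1 ∈ #2))) <->
    forall q, D q -> rational q -> forall p, D p -> I p a -> before q p -> I q a.
  rewrite holds_AllIn ren_QQ; split=> H q qD.
    move=> /(ratE q e)/(H q qD)/(holds_AllInV (q .: e) 1) qa p pD pa.
    by have /holds_Imp := qa p pD pa; rewrite ltE1 holds_MemV.
  move=> /(ratE q e) qQ; apply/(holds_AllInV (q .: e) 1) => p pD pa.
  by apply/holds_Imp; rewrite ltE1 holds_MemV; apply: H.
have H5 : holds e (ExIn #0 (AllIn #1 (ltQ #0 #1 ∨ #0 ≐ #1))) <->
    exists g, [/\ D g, I g a & forall p, D p -> I p a -> beyond p g \/ E p g].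
  have Or p g : holds (p .: g .: e) (ltQ #0 #1 ∨ #0 ≐ #1) <-> beyond p g \/ E p g.
    have A := ltE2 p g; have B := holds_EquV (p .: g .: e) 0 1.
    by split=> -[/A ?|/B ?]; [left | right | left | right].
  rewrite holds_ExInV; split=> -[g [gD ga gP]]; exists g; split=> //.
    move=> p pD pa; exact: (Or p g).1 ((holds_AllInV (g .: e) 1 _).1 gP p pD pa).
  by apply/(holds_AllInV (g .: e) 1) => p pD pa; apply/Or; apply: gP.
split=> [[/H1 c1 [/H2 c2 [/H3 c3 [/H4 c4 c5]]]]|[/H1 c1 /H2 c2 /H3 c3 /H4 c4 c5]].
  by split=> // /H5.
by do 4![split; first by []] => /H5.
Qed.

(** * Suprema as unions *)

Definition ub (x b : M) : Prop := forall r, D r -> I r x -> sub r b.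

Definition bounded (x : M) : Prop :=
  [/\ forall r, D r -> I r x -> cut r, exists r, D r /\ I r x
    & exists b, [/\ D b, cut b & ub x b]].

Definition lub (x s : M) : Prop :=
  [/\ cut s, ub x s & forall b, D b -> cut b -> ub x b -> sub s b].

Definition is_union (u x : M) : Prop :=
  D u /\ forall q, D q -> (I q u <-> exists r, [/\ D r, I r x & I q r]).

Lemma union_ub u x : is_union u x -> ub x u.
Proof. by move=> [_ uP] r rD rx q qD qr; apply/uP => //; exists r. Qed.

Lemma union_least u x b : is_union u x -> ub x b -> sub u b.
Proof. by move=> [_ uP] xb q qD /uP [] // r [rD rx qr]; apply: (xb r). Qed.

(** Inclusion in Q and difference from Q come from the bound [b]. The other clauses come from the
    members: each point of the union lies in some cut [r'] of [x], and a greatest point of the union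
    would be greatest in that [r']. *)
Lemma union_cut u x : is_union u x -> bounded x -> cut u.
Proof.
move=> uU [xR [r [rD rx]] [b [bD bR xb]]]; have [uD uP] := uU.
have ub := union_least uU xb.
have [bQ _ bN _ _] := (cutP bD).1 bR.
apply/(cutP uD); split.
- by move=> q qD /(ub q qD); apply: bQ.
- have [_ [q [qD qr]] _ _ _] := (cutP rD).1 (xR r rD rx).
  by exists q; split=> //; apply: (union_ub uU rD rx).
(* If the union were Q, then [b], which lies between the union and Q, would be Q as well. *)
- move=> uQ; apply: bN; apply: (val_E str uQ); apply: sub_antisym => // q qD.
  move=> /(bQ q qD) [c [d [cq dQ cd]]].
  apply: (I_congr str) cd; first exact: cq.
  by apply: (val_inj str (e := q .: cst) (t := QQ) dQ); rewrite -(ren_QQ succn); apply/val_shift.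
- move=> q qD qQ p pD /uP [] // r' [r'D r'x pr'] qp; apply/uP => //.
  have [_ _ _ r'down _] := (cutP r'D).1 (xR r' r'D r'x).
  by exists r'; split=> //; apply: (r'down q qD qQ p).
- move=> [g [gD /uP [] // r' [r'D r'x gr'] gmax]].
  have [_ _ _ _ r'max] := (cutP r'D).1 (xR r' r'D r'x).
  apply: r'max; exists g; split=> // p pD pr'; apply: gmax => //.
  by apply/uP => //; exists r'.
Qed.

Lemma union_lub u x : is_union u x -> bounded x -> lub x u.
Proof.
move=> uU xb; split; [exact: union_cut uU xb | exact: union_ub|].
by move=> b _ _; apply: union_least.
Qed.

Lemma bounded_union u x : is_union u x -> (bounded x <->
  [/\ forall r, D r -> I r x -> cut r, exists r, D r /\ I r x & cut u]).
Proof.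
move=> uU; split=> [xb|[xR xN uR]].
  by have [xR xN _] := xb; split=> //; apply: union_cut uU xb.
by split=> //; exists u; split=> //; [case: uU | apply: union_ub].
Qed.

(** Lets the clause equating y with [big_cup] of x stand for being the least upper bound: two least
    upper bounds include each other, and the property is transported along [E]. *)
Lemma lub_unique u x s : D s -> is_union u x -> bounded x -> (lub x s <-> E s u).
Proof.
move=> sD uU xb; have [uR uub uleast] := union_lub uU xb; have [uD _] := uU.
split=> [[sR sub sleast]|su].
  by apply: sub_antisym => //; [apply: sleast | apply: uleast].
have su' q : D q -> (I q s <-> I q u).
  have us := E_sym str su; have rf := E_refl str q.
  by move=> qD; split; apply: (I_congr str).
split; first exact/(cut_congr su).
  by move=> r rD rx q qD qr; apply/su' => //; apply: (uub r).
by move=> b bD bR xb' q qD /su' qu; apply: (uleast b) => //; apply: qu.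
Qed.

Lemma val_big_cup e n u : val e (big_cup #n) u <-> is_union u (e n).
Proof.
have H b : holds (b .: e) (ExIn ↑(#n) (#1 ∈ #0)) <->
    exists r, [/\ D r, I r (e n) & I b r].
  rewrite -[↑(#n)]/(#(n.+1)) holds_ExInV.
  have K r := holds_MemV (r .: b .: e) 1 0.
  by split=> -[r [rD rn br]]; exists r; split=> //; apply/K.
by split=> -[uD uP]; split=> // b bD; split=> [/(uP b bD)/H|/H/(uP b bD)].
Qed.

Lemma union_exists x : D x -> exists u, is_union u x.
Proof. by move=> xD; have [u [uD uP]] := has_union str xD; exists u. Qed.

Lemma holds_inC_RR e n : holds e (inC #n RR) <-> cut (e n).
Proof. by rewrite (holds_inst str _ (val_Var str e n)) cut_tail. Qed.

Lemma holds_upper_bound e m n : holds e (upper_bound #m #n) <-> ub (e m) (e n).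
Proof.
by rewrite holds_AllInV; split=> H r rD rm; have := H r rD rm;
  rewrite -[↑(#n)]/(#(n.+1)) holds_SubsetV.
Qed.

Lemma holds_bounded_subset e n : D (e n) ->
  (holds e (bounded_subset #n) <-> bounded (e n)).
Proof.
move=> nD.
have H1 : holds e (AllIn #n (inC #0 RR)) <-> forall r, D r -> I r (e n) -> cut r.
  by rewrite holds_AllInV; split=> H r rD rn; apply/(holds_inC_RR (r .: e) 0)/H.
have H3 : holds e (Ex (inC #0 RR ∧ upper_bound #(n.+1) #0)) <->
    exists b, [/\ D b, cut b & ub (e n) b].
  split=> [[b [bD [/holds_inC_RR bR /holds_upper_bound nb]]]|[b [bD bR nb]]].
    by exists b.
  by exists b; split=> //; split; [apply/holds_inC_RR | apply/holds_upper_bound].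
have H2 := holds_nonempty nD.
by split=> [[/H1 ? [/H2 ? /H3 ?]]|[/H1 ? /H2 ? /H3 ?]].
Qed.

Lemma holds_is_lub e m n : holds e (is_lub #m #n) <-> lub (e m) (e n).
Proof.
have H : holds e (All (inC #0 RR ∧ upper_bound #(m.+1) #0 ⇒ Subset #(n.+1) #0)) <->
    forall b, D b -> cut b -> ub (e m) b -> sub (e n) b.
  rewrite holds_All; split=> H b bD.
    move=> bR mb; have /holds_Imp := H b bD; rewrite holds_SubsetV; apply.
    by split; [apply/holds_inC_RR | apply/holds_upper_bound].
  apply/holds_Imp => -[/holds_inC_RR bR /holds_upper_bound mb].
  by apply/holds_SubsetV; apply: H.
have H1 := holds_inC_RR e n; have H2 := holds_upper_bound e m n.
by split=> [[/H1 ? [/H2 ? /H ?]]|[/H1 ? /H2 ? /H ?]].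
Qed.

Lemma holds_bounded_class e : D (e 0) -> (holds e bounded_class <-> bounded (e 0)).
Proof.
move=> xD; have [u uU] := union_exists xD; rewrite (bounded_union uU).
have H1 : holds e (AllIn #0 (inC #0 RR)) <-> forall r, D r -> I r (e 0) -> cut r.
  by rewrite holds_AllInV; split=> H r rD rn; apply/(holds_inC_RR (r .: e) 0)/H.
have H3 : holds e (inC (big_cup #0) RR) <-> cut u.
  have uv : val e (big_cup #0) u by apply/val_big_cup.
  by rewrite (holds_inst str RR uv) cut_tail.
have H2 := holds_nonempty xD.
by split=> [[/H1 ? [/H2 ? /H3 ?]]|[/H1 ? /H2 ? /H3 ?]].
Qed.

(** * Kuratowski pairs and the class term of the supremum map *)

Definition is_pair (p a b : M) : Prop :=
  D p /\ forall d, D d -> (I d p <-> E d a \/ E d b).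

Definition is_ordered_pair (p x y : M) : Prop :=
  exists s d, [/\ is_pair s x x, is_pair d x y & is_pair p s d].

Lemma pair_exists a b : D a -> D b -> exists p, is_pair p a b.
Proof. by move=> aD bD; have [p [pD pP]] := has_pair str aD bD; exists p. Qed.

Lemma ordered_pair_exists x y : D x -> D y -> exists p, is_ordered_pair p x y.
Proof.
move=> xD yD; have [s sP] := pair_exists xD xD; have [d dP] := pair_exists xD yD.
by have [p pP] := pair_exists sP.1 dP.1; exists p, s, d.
Qed.

Lemma is_pair_inj p a b a' b' : D a -> D b -> D a' -> D b' ->
  is_pair p a b -> is_pair p a' b' -> (E a a' /\ E b b') \/ (E a b' /\ E b a').
Proof.
have sym := E_sym str; have tr := E_trans str.
move=> aD bD a'D b'D [_ pP] [_ pP'].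
have Ha := (pP' a aD).1 ((pP a aD).2 (or_introl (E_refl str a))).
have Hb := (pP' b bD).1 ((pP b bD).2 (or_intror (E_refl str b))).
have Ha' := (pP a' a'D).1 ((pP' a' a'D).2 (or_introl (E_refl str a'))).
have Hb' := (pP b' b'D).1 ((pP' b' b'D).2 (or_intror (E_refl str b'))).
by case: Ha Hb Ha' Hb' => [?|?] [?|?] [?|?] [?|?]; (left + right);
   split; eauto 6.
Qed.

Lemma is_ordered_pair_inj p x y x' y' : D x -> D y -> D x' -> D y' ->
  is_ordered_pair p x y -> is_ordered_pair p x' y' -> E x x' /\ E y y'.
Proof.
have sym := E_sym str; have tr := E_trans str.
have pE s t a b : E s t -> is_pair s a b -> is_pair t a b.
  move=> st [sD sP]; split=> [|d dD]; first exact: (D_congr str) st sD.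
  by rewrite -sP //; split; apply: (I_congr str) => //; [apply: (E_refl str) | apply: sym
    | apply: (E_refl str)].
move=> xD yD x'D y'D [s [d [sP dP pP]]] [s' [d' [sP' dP' pP']]].
have := is_pair_inj sP.1 dP.1 sP'.1 dP'.1 pP pP' => -[[ss dd]|[sd ds]].
  have [[xx _]|[xx _]] := is_pair_inj xD xD x'D x'D (pE _ _ _ _ ss sP) sP';
    split=> //; have := is_pair_inj xD yD x'D y'D (pE _ _ _ _ dd dP) dP';
    by case=> [[]|[]] //; eauto.
(* Crossed case: the singleton of [x] equals the pair of [x'] and [y'], and the pair of [x] and [y]
   equals the singleton of [x'], so all four components coincide. *)
have := is_pair_inj xD xD x'D y'D (pE _ _ _ _ sd sP) dP'.
have := is_pair_inj xD yD x'D x'D (pE _ _ _ _ ds dP) sP'.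
by case=> -[? ?] [[? ?]|[? ?]]; split; eauto.
Qed.

Lemma val_upair e s t a b p : val e s a -> val e t b ->
  (val e (upair s t) p <-> is_pair p a b).
Proof.
move=> sa tb.
have H d : holds (d .: e) (#0 ≐ ↑s ∨ #0 ≐ ↑t) <-> E d a \/ E d b.
  have H1 : holds (d .: e) (#0 ≐ ↑s) <-> E d a.
    by apply: (holds_Equ str); [exact: val_Var | apply/val_shift].
  have H2 : holds (d .: e) (#0 ≐ ↑t) <-> E d b.
    by apply: (holds_Equ str); [exact: val_Var | apply/val_shift].
  by rewrite -H1 -H2.
by split=> -[pD pP]; split=> // d dD; split=> [/(pP d dD)/H|/H/(pP d dD)].
Qed.

Lemma val_sg e s a p : val e s a -> (val e (sg s) p <-> is_pair p a a).
Proof.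
move=> sa.
have H d : holds (d .: e) (#0 ≐ ↑s) <-> E d a.
  by apply: (holds_Equ str); [exact: val_Var | apply/val_shift].
have H' d : holds (d .: e) (#0 ≐ ↑s) <-> E d a \/ E d a by rewrite H; tauto.
by split=> -[pD pP]; split=> // d dD; split=> [/(pP d dD)/H'|/H'/(pP d dD)].
Qed.

Lemma val_opair e s t a b p : D a -> D b -> val e s a -> val e t b ->
  (val e (opair s t) p <-> is_ordered_pair p a b).
Proof.
move=> aD bD sa tb; split=> [pv|[u [d [/(val_sg _ sa) uP /(val_upair _ sa tb) dP]]]].
  have [u uP] := pair_exists aD aD; have [d dP] := pair_exists aD bD.
  exists u, d; split=> //.
  have /(val_sg _ sa) uv := uP; have /(val_upair _ sa tb) dv := dP.
  by apply/(val_upair _ uv dv).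
by move/(val_upair _ uP dP).
Qed.

Lemma holds_is_opair e p x y : (forall n, D (e n)) ->
  (holds e (is_opair #p #x #y) <-> is_ordered_pair (e p) (e x) (e y)).
Proof.
move=> eD; have opairE u : D u -> holds (u .: e) (#(p.+1) ≐ opair #(x.+1) #(y.+1)) <->
    is_ordered_pair (e p) (e x) (e y).
  move=> uD; have [c cP] := ordered_pair_exists (eD x) (eD y).
  have cv : val (u .: e) (opair #(x.+1) #(y.+1)) c.
    by apply/(@val_opair _ _ _ (e x) (e y)) => //; exact: (val_Var str).
  have pv := val_Var str (u .: e) p.+1.
  split=> [[a [b [pa bv ab]]]|].
    apply/(@val_opair (u .: e) #(x.+1) #(y.+1)); [exact: eD..| | |];
      do ?exact: (val_Var str).
    by apply: (val_E str (e := u .: e) (t := opair #(x.+1) #(y.+1)) bv); apply: (E_trans str) pa; apply: (E_sym str).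
  move=> pP; exists (e p), (e p); split; [exact: pv | | exact: (E_refl str)].
  by apply/(@val_opair _ _ _ (e x) (e y)) => //; exact: (val_Var str).
rewrite holds_ExInV; split=> [[u [uD _ [_ [_ /(opairE _ uD)]]]] //|pP].
have [s [d [sP dP [pD dp]]]] := pP; have [dD dP'] := dP.
(* [d], the unordered pair of the components, is the member of the pair that the quantifier in
   [is_opair] asks for. *)
exists d; split=> //; first by apply/dp => //; right; apply: (E_refl str).
split; first by apply/(holds_MemV (d .: e) x.+1 0)/(dP' (e x) (eD x)); left; apply: (E_refl str).
split; first by apply/(holds_MemV (d .: e) y.+1 0)/(dP' (e y) (eD y)); right; apply: (E_refl str).
exact/(opairE d dD).
Qed.

Definition lub_class : form := fun_class bounded_class (big_cup #0).

Lemma holds_lub_class e : (forall n, D (e n)) -> (holds e lub_class <->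
  exists x s, [/\ D x, D s, is_ordered_pair (e 0) x s & bounded x /\ lub x s]).
Proof.
move=> eD.
have DD x s n : D x -> D s -> D ((s .: x .: e) n) by case: n => [|[|n]] //=.
have bodyE x s : D x -> D s ->
    holds (s .: x .: e) (inC #1 bounded_class ∧ #0 ≐ big_cup #1) <->
    bounded x /\ lub x s.
  move=> xD sD; set d := s .: x .: e.
  have H1 : holds d (inC #1 bounded_class) <-> bounded x.
    by rewrite (holds_inst str _ (val_Var str d 1)) holds_bounded_class.
  have [u uU] := union_exists xD.
  have H2 : holds d (#0 ≐ big_cup #1) <-> E s u.
    by apply: (holds_Equ str (val_Var str d 0)); apply/val_big_cup.
  split=> [[/H1 xb /H2 su]|[xb xs]]; first by split=> //; apply/(lub_unique sD uU).
  by split; [apply/H1 | apply/H2/(lub_unique sD uU xb)].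
have pairE x s (xD : D x) (sD : D s) :=
  holds_is_opair 2 1 0 (fun n => DD x s n xD sD).
split=> [[x [xD [s [sD [/(pairE x s xD sD) xs /(bodyE x s xD sD) xsP]]]]]|].
  by exists x, s.
case=> x [s [xD sD xs xsP]]; exists x; split=> //; exists s; split=> //.
by split; [apply/(pairE x s xD sD) | apply/bodyE].
Qed.

(** Read off from the formula expressing the notion, whose truth is invariant under [E], rather than
    clause by clause. *)
Lemma bounded_congr x y : D x -> E x y -> bounded x -> bounded y.
Proof.
move=> xD xy; have yD := D_congr str xy xD.
rewrite -(@holds_bounded_subset (x .: cst) 0) // -(@holds_bounded_subset (y .: cst) 0) //.
by apply: (holds_congr str _ _).1 => -[|n] //=; apply: (E_refl str).
Qed.

Lemma lub_congr x y s t : E x y -> E s t -> lub x s -> lub y t.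
Proof.
move=> xy st.
rewrite -(@holds_is_lub (x .: s .: cst) 0 1) -(@holds_is_lub (y .: t .: cst) 0 1).
by apply: (holds_congr str _ _).1 => -[|[|n]] //=; apply: (E_refl str).
Qed.

Lemma holds_lub_exists e : (forall n, D (e n)) -> holds e lub_exists.
Proof.
move=> eD; apply/holds_All => x xD; apply/holds_Imp.
rewrite holds_bounded_subset // => xb; have [u uU] := union_exists xD.
by exists u; split; [case: uU | apply/holds_is_lub; apply: union_lub].
Qed.

Lemma holds_lub_property e : (forall n, D (e n)) -> holds e (lub_property lub_class).
Proof.
move=> eD; apply/holds_All => x xD; apply/holds_All => y yD; apply/holds_Iff.
set d := y .: x .: e; have dD n : D (d n) by case: n => [|[|n]] //=.
have [p pP] := ordered_pair_exists xD yD.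
have pD : D p by case: pP => s [c [_ _ []]].
have pv : val d (opair #1 #0) p.
  by apply/(@val_opair _ _ _ x y) => //; exact: (val_Var str).
have peD n : D ((p .: d) n) by case: n => [|n] //=.
have H1 := holds_bounded_subset (e := d) (n := 1) xD.
have H2 := holds_is_lub d 1 0.
rewrite (holds_inst str _ pv) holds_lub_class //.
split=> [[x' [y' [x'D y'D pP' [x'b xy]]]]|[/H1 xb /H2 xy]]; last by exists x, y.
(* Membership in the class only gives some decomposition of [p]; injectivity of pairing identifies
   it with the given one. *)
have [xx yy] := is_ordered_pair_inj x'D y'D xD yD pP' pP.
by split; [apply/H1/(bounded_congr x'D xx) | apply/H2/(lub_congr xx yy)].
Qed.

End Suprema.

(** * The structure on [J2] *)

Lemma eqV_refl x : eqV x x.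
Proof. by elim: x => A f IH; split=> a; exists a. Qed.

Lemma eqV_sym x y : eqV x y -> eqV y x.
Proof.
elim: x y => A f IH [B g] [fg gf].
by split=> [b|a]; [have [a ab] := gf b; exists a | have [b ab] := fg a; exists b]; apply: IH.
Qed.

Lemma eqV_trans x y z : eqV x y -> eqV y z -> eqV x z.
Proof.
elim: x y z => A f IH [B g] [C k] [fg gf] [gk kg]; split=> [a|c].
  by have [b ab] := fg a; have [c bc] := gk b; exists c; apply: IH ab bc.
by have [b bc] := kg c; have [a ab] := gf b; exists a; apply: IH ab bc.
Qed.

Lemma memV_elt x (i : idx x) : memV (elt i) x.
Proof. by exists i; apply: eqV_refl. Qed.

Lemma eqVP x y : eqV x y <-> forall z, memV z x <-> memV z y.
Proof.
case: x y => A f [B g]; split=> [[fg gf] z|H].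
  split=> -[i zi]; [have [b ib] := fg i; exists b | have [a ai] := gf i; exists a].
    exact: eqV_trans zi ib.
  exact: eqV_trans zi (eqV_sym ai).
split=> [a|b]; first by have [b] := (H (f a)).1 (@memV_elt (sup f) a); exists b.
by have [a] := (H (g b)).2 (@memV_elt (sup g) b); exists a; apply: eqV_sym.
Qed.

Lemma memV_congr a b c d : eqV a b -> eqV c d -> memV a c -> memV b d.
Proof.
move=> ab /eqVP cd /cd [i ai]; exists i; apply: eqV_trans ai.
exact: eqV_sym.
Qed.

Lemma mem_emptyV z : ~ memV z emptyV.
Proof. by case=> -[]. Qed.

Lemma mem_pairV z x y : memV z (pairV x y) <-> eqV z x \/ eqV z y.
Proof.
by split=> [[[] ]|[zx|zy]]; [left | right | exists true | exists false].
Qed.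

Lemma mem_diffV z x y : memV z (diffV x y) <-> memV z x /\ ~ memV z y.
Proof.
split=> [[[i iy] /= zi]|[[i zi] zy]].
  split; first by exists i.
  by move=> zy; apply: iy; apply: memV_congr zy => //; apply: eqV_refl.
have iy : ~ memV (elt i) y.
  by move=> iy; apply: zy; apply: memV_congr iy; [apply: eqV_sym | apply: eqV_refl].
by exists (exist _ i iy).
Qed.

Lemma mem_bigcupV z x g : memV z (bigcupV x g) <-> exists i : idx x, memV z (g (elt i)).
Proof.
by split=> [[[i j] zj]|[i [j zj]]]; [exists i, j | exists (existT _ i j)].
Qed.

Lemma mem_adjV z x y : memV z (adjV x y) <-> memV z x \/ eqV z y.
Proof.
split=> [[[i|] zi]|[[i zi]|zy]]; [by left; exists i | by right | by exists (Some i)|].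
by exists None.
Qed.

Lemma J2_pairV a b : J2 a -> J2 b -> J2 (pairV a b).
Proof.
move=> aJ bJ; pose x (i : 'I_2) := if i == ord0 then a else b.
by apply: (@J2_rud 2 _ x (rud_pair ord0 ord_max)) => i; rewrite /x; case: ifP.
Qed.

Lemma J2_bigcupV a : J2 a -> J2 (bigcupV a id).
Proof.
move=> aJ; pose x (i : 'I_1) := a.
have := @J2_rud 1 _ x (rud_bigcup (@rud_proj 1 ord0)) (fun _ => aJ).
congr J2; congr bigcupV; apply: functional_extensionality => z.
by rewrite /consV unlift_none.
Qed.

(* [J2] is transitive because rudimentary functions preserve this property. *)
Fixpoint hered_J2 (x : V) : Prop :=
  let: sup A f := x in J2 (sup f) /\ forall a, hered_J2 (f a).

Lemma hered_J2_congr x y : eqV x y -> hered_J2 x -> hered_J2 y.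
Proof.
elim: x y => A f IH [B g] xy [xJ fJ]; split; first exact: J2_eq xy xJ.
by case: xy => _ gf b; have [a ab] := gf b; apply: IH ab (fJ a).
Qed.

Lemma hered_J2P x : hered_J2 x <-> J2 x /\ forall z, memV z x -> hered_J2 z.
Proof.
split=> [|[]].
  case: x => A f [fJ fH]; split=> // z [a za].
  by apply: hered_J2_congr (fH a); apply: eqV_sym.
by case: x => A f fJ H; split=> // a; apply: H; apply: (@memV_elt (sup f)).
Qed.

(** That the value lies in [J2] is closure itself, so the induction controls its elements: those of
    an argument for a difference, copies of arguments for a pair, elements of values of [g] at
    hereditary arguments for a union. *)
Lemma hered_J2_rud n f : @rudimentary n f -> forall x,
  (forall i, hered_J2 (x i)) -> hered_J2 (f x).
Proof.
move=> fR; have J x : (forall i, hered_J2 (x i)) -> J2 (f x).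
  by move=> xH; apply: J2_rud => // i; have [] := (hered_J2P (x i)).1 (xH i).
elim: n f / fR J => [n i|n i j|n i j|n k g h gR IHg hR IHh|n g gR IH] J x xH.
- exact: xH.
- apply/hered_J2P; split=> [|z /mem_diffV [zi _]]; first exact: J.
  by have [_] := (hered_J2P (x i)).1 (xH i); apply.
- apply/hered_J2P; split=> [|z /mem_pairV [] zi]; first exact: J.
    by apply: hered_J2_congr (xH i); apply: eqV_sym.
  by apply: hered_J2_congr (xH j); apply: eqV_sym.
- have rudJ m k' : rudimentary k' -> forall y : 'I_m -> V, (forall i, hered_J2 (y i)) -> J2 (k' y).
    by move=> k'R y yH; apply: J2_rud => // i; have [] := (hered_J2P (y i)).1 (yH i).
  by apply: IHg => [|i]; [exact: rudJ | apply: IHh => //; apply: rudJ].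
- apply/hered_J2P; split=> [|z /mem_bigcupV [i zi]]; first exact: J.
  set y := consV _ _ in zi.
  have yH j : hered_J2 (y j).
    rewrite /y /consV; case: unliftP => [j' _|_]; first exact: xH.
    by have [_] := (hered_J2P (x ord0)).1 (xH ord0); apply; apply: memV_elt.
  have gH : hered_J2 (g y).
    apply: IH => // w wH; apply: J2_rud => // j.
    by have [] := (hered_J2P (w j)).1 (wH j).
  by have [_] := (hered_J2P (g y)).1 gH; apply.
Qed.

Lemma J2_hered x : J2 x -> hered_J2 x.
Proof.
have hfH c : hered_J2 (hfval c).
  elim: c => [|a IHa b IHb]; apply/hered_J2P; split.
  - by apply: J2_HF_elt; apply: (@memV_elt HFV hf0).
  - by move=> z /mem_emptyV.
  - by apply: J2_HF_elt; apply: (@memV_elt HFV (hfadj a b)).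
  - move=> z /mem_adjV [za|zb]; first by have [_] := (hered_J2P _).1 IHa; apply.
    by apply: hered_J2_congr IHb; apply: eqV_sym.
have memH z : memV z HFV -> hered_J2 z.
  by case=> c zc; apply: hered_J2_congr (hfH c); apply: eqV_sym.
elim=> {x} [x y xy _ xH|x /memH //||n f x fR _ xH].
- exact: hered_J2_congr xH.
- by apply/hered_J2P; split; [apply: J2_HF | apply: memH].
- exact: hered_J2_rud.
Qed.

Lemma J2_trans x z : J2 x -> memV z x -> J2 z.
Proof.
move=> /J2_hered /hered_J2P [_ xH] /xH zH.
by have [] := (hered_J2P z).1 zH.
Qed.

(** Extensionality here compares only members that lie in [J2]; by transitivity these are all the
    members, whence [eqV]. Transitivity also puts the intermediate set of a union into the
    domain. *)
Lemma J2_structure : structure J2 eqV memV HFV.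
Proof.
have J0 : J2 emptyV by apply: J2_HF_elt; apply: (@memV_elt HFV hf0).
split.
- exact: eqV_refl.
- exact: eqV_sym.
- exact: eqV_trans.
- exact: memV_congr.
- by move=> a b; apply: J2_eq.
- exact: J2_HF.
- move=> a b aJ bJ ab; apply/eqVP => z.
  by split=> zm; have zJ := J2_trans _ zm; apply/ab => //; apply: zJ.
- by exists emptyV; split=> // b _; apply: mem_emptyV.
- move=> a b aJ bJ; exists (pairV a b); split; first exact: J2_pairV.
  by move=> d _; apply: mem_pairV.
- move=> a aJ; exists (bigcupV a id); split; first exact: J2_bigcupV.
  move=> d _; split=> [/mem_bigcupV [i di]|[b [bJ [i bi] db]]].
    by exists (elt i); split=> //; [apply: (J2_trans aJ) | ]; apply: memV_elt.
  apply/mem_bigcupV; exists i; apply: memV_congr db => //; exact: eqV_refl.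
Qed.

Notation J2_val := (val J2 eqV memV HFV).
Notation J2_holds := (holds J2 eqV memV HFV).

(** * Every element of [J2] is the value of a closed term *)

(** Arguments are terms, so composition just hands the terms of the inner functions to the outer
    one. Tracking free variables makes closed arguments give a closed term, and in the union case it
    keeps the abstracted variable out of [t], as legality of the abstraction demands. *)
Lemma rudimentary_term n f : @rudimentary n f -> forall s : 'I_n -> term,
  (forall i, wf_t (s i)) -> exists t,
  [/\ wf_t t, (forall k, fv_t k t -> exists i, fv_t k (s i))
    & forall e x, (forall m, J2 (e m)) -> (forall i, J2_val e (s i) (x i)) ->
      J2_val e t (f x)].
Proof.
have str := J2_structure.
have xJ m (s : 'I_m -> term) e (x : 'I_m -> V) : (forall m, J2 (e m)) ->
    (forall i, J2_val e (s i) (x i)) -> forall i, J2 (x i).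
  by move=> eJ sx i; apply: (val_D str eJ (sx i)).
elim=> {n f} [n i|n i j|n i j|n k g h gR IHg hR IHh|n g gR IH] s sw.
- by exists (s i); split=> //; exists i.
- exists (Abs (#0 ∈ ↑(s i) ∧ ¬ #0 ∈ ↑(s j))); split.
  + constructor; apply: safe_And0r; last by auto with legal.
    by constructor; [apply: wf_shift | apply: fv_shift0].
  + by move=> k /orP [] /fv_shift; [exists i | exists j].
  + move=> e x eJ sx; split.
      exact: (J2_rud (rud_diff i j)) (xJ _ _ _ _ eJ sx).
    move=> b bJ.
    have H l : J2_holds (b .: e) (#0 ∈ ↑(s l)) <-> memV b (x l).
      by apply: (holds_Mem str); [exact: (val_Var str) | apply/val_shift].
    have Hi := H i; have Hj := H j.
    by rewrite mem_diffV; split=> [[/Hi ? nj]|[/Hi ? nj]]; split=> // /Hj.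
- exists (upair (s i) (s j)); split; first exact: wf_upair.
    by move=> k /fv_upair /orP []; [exists i | exists j].
  move=> e x eJ sx; apply/(val_upair str _ (sx i) (sx j)).
  split=> [|d _]; last exact: mem_pairV.
  exact: (J2_rud (rud_pair i j)) (xJ _ _ _ _ eJ sx).
- have [th thP] := fin_all_exists (fun i => IHh i s sw).
  have [|t [tw tf tv]] := IHg th; first by move=> i; have [] := thP i.
  exists t; split=> // [l /tf [i]|e x eJ sx]; first by have [_ fi _] := thP i; apply: fi.
  by apply: tv => // i; have [_ _ vi] := thP i; apply: vi.
(* Under the binders of the abstraction and of the bounded quantifier, [#0] is the first argument of
   [g], and the remaining arguments are shifted twice. *)
- pose s' i := if unlift ord0 i is Some j then ↑(↑(s (lift ord0 j))) else #0.
  have [|t [tw tf tv]] := IH s'.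
    by move=> i; rewrite /s'; case: unliftP => *; auto with legal.
  have tf' k : fv_t k.+1 t -> exists i, fv_t k ↑(s i).
    move=> /tf [i]; rewrite /s'; case: unliftP => [j _ /fv_shift|//].
    by exists (lift ord0 j).
  exists (Abs (ExIn ↑(s ord0) (#1 ∈ t))); split.
  + constructor; apply: safe_ExIn1; [exact: wf_shift | exact: fv_shift0|].
    constructor=> //; apply/negP => /tf' [i].
    by apply/negP/fv_shift0.
  + move=> k /orP [] /=; first by move=> /fv_shift/fv_shift; exists ord0.
    by move=> /tf' [i /fv_shift]; exists i.
  + move=> e x eJ sx; split.
      exact: (J2_rud (rud_bigcup gR)) (xJ _ _ _ _ eJ sx).
    move=> b bJ.
    have eJ' z : J2 z -> forall m, J2 ((z .: b .: e) m) by move=> zJ [|[|m]] //=.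
    have s0 z : J2_holds (z .: b .: e) (#0 ∈ ↑(↑(s ord0))) <-> memV z (x ord0).
      apply: (holds_Mem str); [exact: (val_Var str) | apply/val_shift/val_shift].
      exact: sx.
    (* [z'] is the argument at which [bigcupV] evaluates [g], and [z] its copy in the assignment. As
       [#0] has every value [eqV] to [z], this avoids appealing to a congruence property of [g]. *)
    have tz z z' : J2 z -> eqV z' z ->
        J2_holds (z .: b .: e) (#1 ∈ t) <->
        memV b (g (consV z' (fun i => x (lift ord0 i)))).
      move=> zJ z'z; apply: (holds_Mem str); first exact: (val_Var str).
      apply: tv => [|i]; first exact: eJ'.
      rewrite /s' /consV; case: unliftP => [j _|_] //.
      by apply/val_shift/val_shift.
    rewrite mem_bigcupV; split=> [[i bi]|[z [zJ [/s0 [i zi] bt]]]].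
      have iJ : J2 (elt i) by apply: (J2_trans (xJ _ _ _ _ eJ sx ord0)); apply: memV_elt.
      exists (elt i); split=> //; split; first by apply/s0/memV_elt.
      exact/(tz _ _ iJ (eqV_refl _)).
    by exists i; apply/(tz z) => //; apply: eqV_sym.
Qed.

Lemma env0_J2 n : J2 (env0 n).
Proof. by apply: J2_HF_elt; apply: (@memV_elt HFV hf0). Qed.

(** Consequently the restriction to succ-subsets excludes nothing in [J2], and a class term, which
    ranges over [J2], can define the domain of the supremum map. *)
Lemma J2_succ_set a : J2 a <-> is_succ_set a.
Proof.
have str := J2_structure.
split; last by case=> t [_ _ ta]; apply: (val_D str env0_J2 ta).
(* Codes are built by adjunction, which [cup s (sg t)] expresses on terms. *)
have hf c : is_succ_set (hfval c).
  elim: c => [|a' [s [sw sc sv]] b [t [tw tc tv]]].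
    exists empty; split=> //; first exact: wf_empty.
    split=> [|b bJ]; first exact: env0_J2 0.
    split=> [/mem_emptyV //|[]]; exact/(holds_EquV str (b .: env0) 0 0)/eqV_refl.
  exists (cup s (sg t)); split; first by apply: wf_cup => //; apply: wf_sg.
    by move=> n; apply/negP => /fv_cup /orP [|/fv_sg]; apply/negP.
  have [u uP] := pair_exists str (val_D str env0_J2 tv) (val_D str env0_J2 tv).
  split=> [|d dJ]; first by apply: J2_HF_elt; apply: (@memV_elt HFV (hfadj a' b)).
  have H1 : J2_holds (d .: env0) (#0 ∈ ↑s) <-> memV d (hfval a').
    by apply: (holds_Mem str); [exact: (val_Var str) | apply/val_shift].
  have H2 : J2_holds (d .: env0) (#0 ∈ ↑(sg t)) <-> memV d u.
    apply: (holds_Mem str); [exact: (val_Var str) | apply/val_shift].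
    exact/(val_sg str _ tv).
  have H3 := uP.2 d dJ; have H4 := mem_adjV d (hfval a') (hfval b).
  split=> [/H4 [?|?]|[/H1 ?|/H2/H3 ?]].
  - by left; apply/H1.
  - by right; apply/H2/H3; left.
  - by apply/H4; left.
  - by apply/H4; right; tauto.
elim=> {a} [x y xy _ [t [tw tc tv]]|x [c xc]||n f x fR _ xS].
- by exists t; split=> //; apply: (val_E str tv xy).
- have [t [tw tc tv]] := hf c; exists t; split=> //.
  by apply: (val_E str tv); apply: eqV_sym.
- by exists HF; split=> //; [constructor | apply: eqV_refl].
have [s sP] := fin_all_exists xS.
have [|t [tw tf tv]] := rudimentary_term fR (s := s); first by move=> i; case: (sP i).
exists t; split=> // [n'|]; first by apply/negP => /tf [i]; apply/negP; case: (sP i).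
by apply: tv => [|i]; [exact: env0_J2 | case: (sP i)].
Qed.

(** * Least upper bounds in [J2] *)

Notation J2_cut := (cut J2 eqV memV HFV).
Notation J2_bounded := (bounded J2 eqV memV HFV).
Notation J2_lub := (lub J2 eqV memV HFV).

(** [sat] and [J2_holds] are convertible, so the two sides differ only in the tail of the
    assignment, which [cut_tail] exchanges. *)
Lemma realE r : real r <-> J2 r /\ J2_cut r.
Proof.
have H := cut_tail J2 eqV memV HFV r env0.
by split=> -[rJ /H].
Qed.

Lemma subVE a b : J2 a -> (subV a b <-> sub J2 memV a b).
Proof.
by move=> aJ; split=> ab z => [_|za]; [apply: ab | apply: ab (za) => //; apply: J2_trans za].
Qed.

Lemma upper_boundVE a b : J2 a -> (upper_boundV a b <-> ub J2 memV a b).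
Proof.
move=> aJ; split=> H r => [rJ ra|ra]; first by apply/subVE/H.
by have rJ := J2_trans aJ ra; apply/subVE => //; apply: H.
Qed.

Lemma bounded_succ_subsetE a : bounded_succ_subset a <-> J2 a /\ J2_bounded a.
Proof.
split=> [[/J2_succ_set aJ aR [r ra] [b [/realE [bJ bR] /(upper_boundVE _ aJ) ab]]]|].
  split=> //; split; [| |by exists b].
    by move=> r' _ /aR /realE [].
  by exists r; split=> //; apply: J2_trans ra.
case=> aJ [aR [r [_ ra]] [b [bJ bR ab]]]; split.
- exact/J2_succ_set.
- by move=> r' r'a; have r'J := J2_trans aJ r'a; apply/realE; split=> //; apply: aR.
- by exists r.
- by exists b; split; [apply/realE | apply/upper_boundVE].
Qed.

Lemma is_lubVE a s : J2 a -> (is_lubV a s <-> J2 s /\ J2_lub a s).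
Proof.
move=> aJ; split=> [[/realE [sJ sR] /(upper_boundVE _ aJ) sU sL]|[sJ [sR sU sL]]].
  split=> //; split=> // b bJ bR /(upper_boundVE _ aJ) ab.
  by apply/subVE => //; apply: sL => //; apply/realE.
split; [by apply/realE | by apply/upper_boundVE|].
by move=> b /realE [bJ bR] /(upper_boundVE _ aJ) ab; apply/subVE => //; apply: sL.
Qed.

Lemma opairVE z a s : J2 a -> J2 s ->
  (eqV z (opairV a s) <-> is_ordered_pair J2 eqV memV z a s).
Proof.
move=> aJ sJ; have str := J2_structure.
have pairE x y p : J2 x -> J2 y -> (eqV p (pairV x y) <-> is_pair J2 eqV memV p x y).
  move=> xJ yJ; have pJ := J2_pairV xJ yJ; split=> [pP|[pD pP]].
    split=> [|d _]; first by apply: J2_eq pJ; apply: eqV_sym.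
    by rewrite -mem_pairV; move/eqVP: pP; apply.
  by apply: (I_ext str) => // d dJ; rewrite pP // mem_pairV.
have P1 := J2_pairV aJ aJ; have P2 := J2_pairV aJ sJ.
split=> [/(pairE _ _ _ P1 P2) zP|[u [d [/(pairE _ _ _ aJ aJ) uP /(pairE _ _ _ aJ sJ) dP]]]].
  exists (pairV a a), (pairV a s); split=> //.
    exact/pairE/eqV_refl.
  exact/pairE/eqV_refl.
case=> zJ zP; apply: (I_ext str) => //; first exact: J2_pairV.
move=> c cJ; rewrite zP // mem_pairV.
have tr := eqV_trans; have sy := eqV_sym.
by split=> -[?|?]; [left | right | left | right]; eauto.
Qed.

Lemma defines_bounded : defines bounded_class bounded_succ_subset.
Proof.
split=> [|a]; first exact: closed_bounded_class.
have H aJ := holds_bounded_class J2_structure (e := a .: env0) aJ.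
rewrite bounded_succ_subsetE; split=> -[aJ aB]; split=> //; exact/(H aJ).
Qed.

Lemma defines_lub_map : defines lub_class lub_map.
Proof.
split=> [|z]; first exact: closed_lub_class.
have zJe : J2 z -> forall n, J2 ((z .: env0) n) by move=> zJ [|n] //=; apply: env0_J2.
split=> [[a [s [/bounded_succ_subsetE [aJ aB] /(is_lubVE _ aJ) [sJ sL] zP]]]|].
  have zJ : J2 z by apply: J2_eq (eqV_sym zP) _; do !apply: J2_pairV.
  split=> //; apply/(holds_lub_class J2_structure (zJe zJ)).
  by exists a, s; split=> //; apply/opairVE.
case=> zJ /(holds_lub_class J2_structure (zJe zJ)) [a [s [aJ sJ zP [aB sL]]]].
exists a, s; split; [exact/bounded_succ_subsetE | exact/is_lubVE|].
exact/opairVE.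
Qed.

Theorem theorem5p3 :
  provable lub_exists /\
  (forall a, bounded_succ_subset a -> exists s, is_lubV a s) /\
  exists (T : form) (t : term),
    is_succ_function T t bounded_succ_subset lub_map /\
    provable (lub_property (fun_class T t)).
Proof.
split; first apply: completeness wf_lub_exists _ => M D E I h str e eD.
  exact: holds_lub_exists.
split=> [a /bounded_succ_subsetE [aJ aB]|].
  have [u uU] := union_exists J2_structure aJ.
  exists u; apply/is_lubVE => //; split; first by case: uU.
  exact: (union_lub J2_structure).
exists bounded_class, (big_cup #0); split.
  split; [exact: defines_bounded | by apply/wf_big_cup/wf_Var | | exact: defines_lub_map].
  by case.
apply: completeness => [|M D E I h str e eD].
  exact: wf_lub_property closed_lub_class.1.
exact: holds_lub_property.
Qed.
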